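(* Assume: (A1) $\mathbb E[\phi_i^4]<\infty$; (A2) $F$ is of class $C^2$ on $[-1,1]$; (A3) $f$ and $f'$ are bounded. Let $m=m_N$ satisfy $m_N\to\infty$ and $\frac{\log m_N}{m_N^2}\to0$ as $N\to\infty$. Then, under the sequential regime $n\to\infty$ first, then $N\to\infty$, there exists a sequence $n=n_N\to\infty$ such that $$\big\|\widehat F_{m_N,n_N,N}-F\big\|\xrightarrow{\text{a.s.}}0,\qquad N\to\infty,$$ where $\|g\|:=\sup_{x\in[-1,1]}|g(x)|$.
   Context: Model. Fix $\sigma>0$, $\gamma>0$, $H\in(\frac12,1)$ and a time step $h>0$. For $i=1,2,\dots$ let $B^i$ be standard Brownian motions and $B^{H,i}$ fractional Brownian motions with Hurst index $H$ (centered Gaussian, covariance $\frac12(t^{2H}+s^{2H}-|t-s|^{2H})$), all mutually independent, and set $M^{H,i}_t=\sigma B^i_t+\gamma B^{H,i}_t$. The random effects $\phi_1,\phi_2,\dots$ are i.i.d. with distribution function $F$ supported on $[-1,1]$ and density $f$, independent of the family $\{M^{H,i}\}$. Put $\theta_i=\phi_i-\frac{\sigma^2}{2}$ and $Y^i_t=\theta_it+M^{H,i}_t$ (so $X^i_t=e^{Y^i_t}$ solves $dX^i_t=\phi_iX^i_t\,dt+X^i_t\,dM^{H,i}_t$, $X^i_0=1$). Statistics. $\Delta Y^i_k:=Y^i_{(k+1)h}-Y^i_{kh}$, $\widehat\theta_i=\frac1{nh}\sum_{k=0}^{n-1}\Delta Y^i_k$, and $\xi^i_n=\frac1n\sum_{k=0}^{n-1}(\Delta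 Y^i_k)^2$, $\eta^i_n=\frac1n\sum_{k=0}^{n-1}\Delta Y^i_k\Delta Y^i_{k+1}$, $\zeta^i_n=\frac1n\sum_{k=0}^{n-1}(Y^i_{(k+2)h}-Y^i_{kh})(Y^i_{(k+4)h}-Y^i_{(k+2)h})$. Averages over $N$ subjects: $\bar V_{n,N}=\frac1N\sum_{i=1}^N\widehat\theta_i^2$, $\bar\xi_{n,N}=\frac1N\sum_{i=1}^N\xi^i_n$, $\bar\eta_{n,N}=\frac1N\sum_{i=1}^N\eta^i_n$, $\bar\zeta_{n,N}=\frac1N\sum_{i=1}^N\zeta^i_n$. Estimators. With $\log_2^+(x):=\mathbf 1_{\{x>0\}}\log_2x$, $\widehat H=\frac12\log_2^+\!\Big(\frac{\bar\zeta_{n,N}-4h^2\bar V_{n,N}}{\bar\eta_{n,N}-h^2\bar V_{n,N}}\Big)$, $\ \widehat\gamma^2=\frac{\bar\eta_{n,N}-h^2\bar V_{n,N}}{h^{2\widehat H}(2^{2\widehat H-1}-1)}$, $\ \widehat\sigma^2=\frac{\bar\xi_{n,N}-h^2\bar V_{n,N}-\widehat\gamma^2h^{2\widehat H}}{h}$, and $\widehat\phi_i=\widehat\theta_i+\frac12\widehat\sigma^2$ for $i=1,\dots,N$. Lagrange estimator. For $m\ge1$ let $x_j=\cos\big(\frac{(2j-1)\pi}{2m}\big)$ for $j=1,\dots,m$ (Chebyshev-Gauss nodes), $\mathcal L_j(x)=\prod_{i=1,\,i\ne j}^m\frac{x-x_i}{x_j-x_i}$, $\widehat F_N(y)=\frac1N\sum_{i=1}^N\mathbf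 1_{\{\widehat\phi_i\le y\}}$, and $\widehat F_{m,n,N}(x)=\sum_{j=1}^m\widehat F_N(x_j)\mathcal L_j(x)$ for $x\in[-1,1]$. *)

(* Defs.v *)
From HB Require Import structures.
From mathcomp Require Export all_boot all_order all_algebra finmap.
From mathcomp Require Export all_classical all_reals all_analysis.
Export Order.TTheory GRing.Theory Num.Theory.
Export numFieldNormedType.Exports.

Set Implicit Arguments.
Unset Strict Implicit.
Unset Printing Implicit Defensive.

Local Open Scope classical_set_scope.
Local Open Scope ring_scope.

Definition sigma_of d (Omega : measurableType d) (R : realType) (T : Type)
    (D : set T) (X : T -> Omega -> R) : set (set Omega) :=
  <<s \bigcup_(t in D) preimage_set_system setT (X t) measurable >>.

Definition mutually_independent d (Omega : measurableType d) (R : realType)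
    (P : probability Omega R) (I : choiceType) (G : I -> set (set Omega)) :=
  forall (J : {fset I}) (A : I -> set Omega),
    (forall i, i \in J -> G i (A i)) ->
    P (\bigcap_(i in [set` J]) A i) = (\prod_(i <- J) P (A i))%E.

Definition independent2 d (Omega : measurableType d) (R : realType)
    (P : probability Omega R) (G1 G2 : set (set Omega)) :=
  forall A1 A2, G1 A1 -> G2 A2 -> P (A1 `&` A2) = (P A1 * P A2)%E.

(* [X] has law N(m, v), with N(m, 0) the Dirac mass at m. The degenerate case
   is separated because [normal_prob m s] takes the standard deviation [s] and
   is the uniform law on [0, 1] when [s = 0]. *)
Definition is_normal d (Omega : measurableType d) (R : realType)
    (P : probability Omega R) (X : Omega -> R) (m v : R) :=
  0 <= v /\
  forall A : set R, measurable A ->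
    P (X @^-1` A) =
      if v == 0 then dirac m A else normal_prob m (Num.sqrt v) A.

(* Processes are indexed by [R], but only times [t >= 0] are ever constrained
   or used. *)
Definition gaussian_process d (Omega : measurableType d) (R : realType)
    (P : probability Omega R) (X : R -> Omega -> R) :=
  forall (k : nat) (t a : 'I_k -> R), (forall j, 0 <= t j) ->
    exists m v : R, is_normal P (fun w => \sum_(j < k) a j * X (t j) w) m v.

Record is_brownian_motion d (Omega : measurableType d) (R : realType)
    (P : probability Omega R) (W : R -> Omega -> R) : Prop := {
  bm_start : {ae P, forall w, W 0 w = 0} ;
  bm_indep_increments : forall t : nat -> R,
    (forall k, 0 <= t k) -> (forall k, t k <= t k.+1) ->
    mutually_independent P (fun k : nat =>
      preimage_set_system setT (fun w => W (t k.+1) w - W (t k) w) measurable) ;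
  bm_normal_increments : forall s t : R, 0 <= s -> s <= t ->
    is_normal P (fun w => W t w - W s w) 0 (t - s) ;
  bm_continuous :
    {ae P, forall w, {within `[0, +oo[, continuous (fun t => W t w)}} }.

Record is_fractional_brownian_motion d (Omega : measurableType d)
    (R : realType) (P : probability Omega R) (H : R) (X : R -> Omega -> R)
    : Prop := {
  fbm_gaussian : gaussian_process P X ;
  fbm_centered : forall t : R, 0 <= t -> ('E_P[X t] = 0)%E ;
  fbm_covariance : forall s t : R, 0 <= s -> 0 <= t ->
    covariance P (X s) (X t) =
      ((t `^ (2 * H) + s `^ (2 * H) - `|t - s| `^ (2 * H)) / 2)%:E }.

Definition has_density d (Omega : measurableType d) (R : realType)
    (P : probability Omega R) (X : {RV P >-> R}) (f : R -> R) :=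
  [/\ measurable_fun setT f, (forall x, 0 <= f x) &
   forall A : set R, measurable A ->
     distribution P X A = (\int[lebesgue_measure]_(x in A) (f x)%:E)%E ].

(* [dg] is the derivative of [g] on [A], one-sided at the end points when [A]
   is a closed interval. *)
Definition has_derivative_on (R : realType) (A : set R) (g dg : R -> R) :=
  forall x, A x -> (g y - g x) / (y - x) @[y --> within A x^'] --> dg x.

Fixpoint class_C (R : realType) (k : nat) (A : set R) (g : R -> R) : Prop :=
  if k is k'.+1 then exists dg, has_derivative_on A g dg /\ class_C k' A dg
  else {within A, continuous g}.

(* Subjects are numbered from 0 throughout. *)

Definition mixed_fbm (R : realType) (Omega : Type) (sigma gamma : R)
    (B BH : nat -> R -> Omega -> R) (i : nat) (t : R) (w : Omega) : R :=
  sigma * B i t w + gamma * BH i t w.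

Definition observed (R : realType) (Omega : Type) (sigma gamma : R)
    (B BH : nat -> R -> Omega -> R) (phi : nat -> Omega -> R)
    (i : nat) (t : R) (w : Omega) : R :=
  (phi i w - sigma ^+ 2 / 2) * t + mixed_fbm sigma gamma B BH i t w.

(* These are functions of one sample path [y], or of the family [Y] of the
   sample paths of all the subjects. *)

Definition increment (R : realType) (h : R) (y : R -> R) (k : nat) : R :=
  y (k.+1%:R * h) - y (k%:R * h).

Definition theta_hat (R : realType) (h : R) (n : nat) (y : R -> R) : R :=
  (n%:R * h)^-1 * \sum_(k < n) increment h y k.

Definition xi (R : realType) (h : R) (n : nat) (y : R -> R) : R :=
  n%:R^-1 * \sum_(k < n) increment h y k ^+ 2.

Definition eta (R : realType) (h : R) (n : nat) (y : R -> R) : R :=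
  n%:R^-1 * \sum_(k < n) increment h y k * increment h y k.+1.

Definition zeta (R : realType) (h : R) (n : nat) (y : R -> R) : R :=
  n%:R^-1 * \sum_(k < n) (y (k.+2%:R * h) - y (k%:R * h)) *
                         (y (k.+4%:R * h) - y (k.+2%:R * h)).

Definition average (R : realType) (N : nat) (v : nat -> R) : R :=
  N%:R^-1 * \sum_(i < N) v i.

Definition V_bar (R : realType) (h : R) (n N : nat) (Y : nat -> R -> R) : R :=
  average N (fun i => theta_hat h n (Y i) ^+ 2).

Definition xi_bar (R : realType) (h : R) (n N : nat) (Y : nat -> R -> R) : R :=
  average N (fun i => xi h n (Y i)).

Definition eta_bar (R : realType) (h : R) (n N : nat) (Y : nat -> R -> R) : R :=
  average N (fun i => eta h n (Y i)).

Definition zeta_bar (R : realType) (h : R) (n N : nat) (Y : nat -> R -> R)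
    : R :=
  average N (fun i => zeta h n (Y i)).

Definition log2_plus (R : realType) (x : R) : R :=
  if 0 < x then ln x / ln 2 else 0.

(* The quotients below inherit the convention [x / 0 = 0]. *)

Definition H_hat (R : realType) (h : R) (n N : nat) (Y : nat -> R -> R) : R :=
  2^-1 * log2_plus
    ((zeta_bar h n N Y - 4 * h ^+ 2 * V_bar h n N Y) /
     (eta_bar h n N Y - h ^+ 2 * V_bar h n N Y)).

Definition gamma2_hat (R : realType) (h : R) (n N : nat) (Y : nat -> R -> R)
    : R :=
  let Hh := H_hat h n N Y in
  (eta_bar h n N Y - h ^+ 2 * V_bar h n N Y) /
  (h `^ (2 * Hh) * (2 `^ (2 * Hh - 1) - 1)).

Definition sigma2_hat (R : realType) (h : R) (n N : nat) (Y : nat -> R -> R)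
    : R :=
  (xi_bar h n N Y - h ^+ 2 * V_bar h n N Y -
   gamma2_hat h n N Y * h `^ (2 * H_hat h n N Y)) / h.

Definition phi_hat (R : realType) (h : R) (n N : nat) (Y : nat -> R -> R)
    (i : nat) : R :=
  theta_hat h n (Y i) + 2^-1 * sigma2_hat h n N Y.

Definition empirical_cdf (R : realType) (N : nat) (v : nat -> R) (y : R) : R :=
  average N (fun i => (v i <= y)%R%:R).

(* Numbered from 0, so that [2 * j + 1] is the usual [2 j - 1]. *)
Definition cheb_node (R : realType) (m j : nat) : R :=
  cos ((2 * j + 1)%N%:R * pi / (2 * m)%N%:R).

Definition lagrange_basis (R : realType) (m : nat) (j : 'I_m) (x : R) : R :=
  \prod_(i < m | i != j)
    ((x - cheb_node R m i) / (cheb_node R m j - cheb_node R m i)).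

Definition lagrange_estimator (R : realType) (h : R) (m n N : nat)
    (Y : nat -> R -> R) (x : R) : R :=
  \sum_(j < m) empirical_cdf N (phi_hat h n N Y) (cheb_node R m j) *
               lagrange_basis j x.

Definition sup_norm (R : realType) (g : R -> R) : \bar R :=
  ereal_sup [set `|g x|%:E | x in `[-1, 1]].

(* Main.v *)
(* Since the empirical distribution function is monotone, its values at the
   Chebyshev nodes enter the interpolation through alternating sums, and the
   error is controlled by the sup norm error at the nodes without the Lebesgue
   constant: keep the 2 K + 1 nodes closest to the point, where the Lipschitz
   continuity of F and the bound 2 on the basis polynomials are enough; the other
   nodes contribute O(1 / K). Hence any m -> oo works, and it suffices that the
   empirical distribution functions of the estimated effects converge uniformly.
   For this, the averages of squares and products of the Brownian and fractional
   Brownian increments converge in L^2 (decay of correlations), so for each N one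
   may choose n_N so large that the sum of the defects over the first N subjects
   has mean at most 2^-N; the defects then vanish almost surely, and the estimated
   effects are uniformly close to the true ones. The law of large numbers on a
   grid and monotonicity conclude. *)

From HB Require Import structures.
Require Import Defs.
From mathcomp Require Import measurable_realfun ring lra zify.

Set Implicit Arguments.
Unset Strict Implicit.
Unset Printing Implicit Defensive.

Local Open Scope classical_set_scope.
Local Open Scope ring_scope.

(** * Chebyshev interpolation of monotone data *)

Section Chebyshev.
Variable R : realType.
Implicit Types (x t a c e C V : R) (m n j k : nat).

(** The alternation comes from a closed form: with nodes $\cos\theta_j$, the $j$-th basis polynomial
    at $\cos t$ is $(-1)^j\cos(mt)\sin\theta_j/(m(\cos t-\cos\theta_j))$, so apart from the sign and
    a common factor only a monotone weight is left. As the basis sums to 1, the error is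
    $\sum_j(g_j-F(x))L_j(x)$, to which alternating-series bounds apply on each side of $x$. Every
    statistic reduces to averages of squared increments through $2ab=(a+b)^2-a^2-b^2$, which is why
    several lags and shifts are controlled together. In the limits of [eta] and [zeta], once the
    drift is subtracted, the Brownian part cancels; what remains are $\gamma^2h^{2H}(2^{2H-1}-1)$
    and $2^{2H}$ times it, nonzero since $H>\frac12$. The fractional increments are never
    independent, so the covariances of their squares need mixed Gaussian fourth moments; these are
    extracted from one-dimensional laws through $(a+b)^4+(a-b)^4$. Randomness enters through means
    and almost sure events only. For a fixed path the rest is deterministic, with one constant valid
    for all $|\phi_i|\le1$. *)

Lemma sin_natpi k : sin (k%:R * pi) = 0 :> R.
Proof.
by elim: k => [|k IH]; rewrite ?mul0r ?sin0// -natr1 mulrDl mul1r sinDpi IH oppr0.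
Qed.

Lemma cos_natpi k : cos (k%:R * pi) = (-1) ^+ k :> R.
Proof.
elim: k => [|k IH]; first by rewrite mul0r cos0 expr0.
by rewrite -natr1 mulrDl mul1r cosDpi IH exprS mulN1r.
Qed.

(** The difference [sin y - y * cos y] has derivative [y * sin y]. This is the elementary inequality
    behind the decay of the basis polynomials away from the point. *)
Lemma mulr_cos_le_sin x : 0 <= x -> x <= pi / 2 -> x * cos x <= sin x.
Proof.
move=> x0 xp.
have [<-|xn0] := eqVneq 0 x; first by rewrite mul0r sin0.
pose f y : R := sin y - y * cos y.
have df (y : R) : is_derive y (1 : R) f (y * sin y).
  by apply: is_derive_eq; rewrite /GRing.scale /=; ring.
have xgt0 : 0 < x by rewrite lt_neqAle xn0.
have [c /andP[c0 cx]] := @MVT R f (fun y => y * sin y) 0 x xgt0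
  (fun y _ => df y) ltac:(by move=> y; apply: continuous_subspaceT => z;
    apply: differentiable_continuous; apply/derivable1_diffP; case: (df z)).
rewrite /f sin0 mul0r !subr0 => E.
rewrite -subr_ge0 E; apply: mulr_ge0 => //; apply: mulr_ge0; first exact: ltW.
apply: sin_ge0_pi; rewrite (ltW c0) /=; move: (pi_gt0 R); rewrite bnd_simp in cx; lra.
Qed.

Lemma cos_dist a (b : R) : `|cos a - cos b| <= `|a - b|.
Proof.
wlog ab : a b / a < b.
  move=> W; case: (ltgtP a b) => [|ba|->]; [exact: W| |by rewrite !subrr].
  by rewrite distrC (distrC a); apply: W.
have [c _ E] := @MVT R (@cos R) (fun y => - sin y) a b ab
  (fun y _ => is_derive_cos y) ltac:(by apply: continuous_subspaceT => z;
    exact: continuous_cos).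
rewrite distrC E normrM normrN (distrC a) -[leRHS]mul1r ler_wpM2r//.
exact: sin_max.
Qed.

(** With half angles [u] and [v], both sides carry the factor [2 * sin (v - u)]. What is left is
    [|cos (v + u)| <= cos (v - u)], which holds because the product of the cosines and that of the
    sines are nonnegative. *)
Lemma sin_dist_le a (b : R) : 0 <= a -> a <= b -> b <= pi ->
  `|sin b - sin a| <= sin (b - a).
Proof.
move=> a0 ab bp.
pose u := a / 2; pose v := b / 2.
have -> : a = u *+ 2 by rewrite /u -mulr_natr divfK.
have -> : b = v *+ 2 by rewrite /v -mulr_natr divfK.
rewrite -mulrnBl !sin_mulr2n.
have -> : (cos v * sin v) *+ 2 - (cos u * sin u) *+ 2 =
          (cos (v + u) * sin (v - u)) *+ 2.
  rewrite cosD sinB; have := cos2Dsin2 u; have := cos2Dsin2 v.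
  move=> hv hu; have -> : (cos v * sin v) *+ 2 - (cos u * sin u) *+ 2 =
    (cos v * sin v * (cos u ^+ 2 + sin u ^+ 2) -
     cos u * sin u * (cos v ^+ 2 + sin v ^+ 2)) *+ 2 by rewrite hv hu; ring.
  by ring.
have pi0 := pi_gt0 R.
have s0 : 0 <= sin (v - u) by apply: sin_ge0_pi; rewrite /u /v; apply/andP; split; lra.
suff : `|cos (v + u)| <= cos (v - u).
  move=> h; rewrite normrMn normrM (ger0_norm s0) lerMn2r /=.
  exact: ler_wpM2r.
have cu : 0 <= cos u by apply: cos_ge0_pihalf; rewrite /u; apply/andP; split; lra.
have cv : 0 <= cos v by apply: cos_ge0_pihalf; rewrite /v; apply/andP; split; lra.
have su : 0 <= sin u by apply: sin_ge0_pi; rewrite /u; apply/andP; split; lra.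
have sv : 0 <= sin v by apply: sin_ge0_pi; rewrite /v; apply/andP; split; lra.
rewrite cosD cosB ler_norml; apply/andP.
have := mulr_ge0 cu cv; have := mulr_ge0 su sv.
by split; lra.
Qed.

(* Monotonicity in the angle [a] of [sin a / (cos t - cos a)]. *)
Lemma sin_cos_cross t a (b : R) : 0 <= a -> a <= b -> b <= pi ->
  sin b * (cos t - cos a) <= sin a * (cos t - cos b).
Proof.
move=> a0 ab bp; have := sin_dist_le a0 ab bp.
rewrite sinB => h.
suff : cos t * (sin b - sin a) <= sin b * cos a - cos b * sin a by lra.
apply: le_trans h; apply: le_trans (ler_norm _) _.
by rewrite normrM -[leRHS]mul1r ler_wpM2r// cos_max.
Qed.

(** In terms of the half sum [s] and the half difference [d], the difference of the cosines is
    [2 * (sin s * sin d)], while [sin a + sin t = 2 * (sin s * cos d)] bounds [sin a]; the rest is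
    [|d| * cos d <= |sin d|]. Distances between nodes are thus traded for distances between angles,
    where the nodes are equally spaced. *)
Lemma sin_mul_dist_le t a : 0 <= t <= pi -> 0 <= a <= pi ->
  sin a * `|a - t| <= 2 * `|cos t - cos a|.
Proof.
move=> /andP[t0 tp] /andP[a0 ap].
pose s := (a + t) / 2; pose d := (a - t) / 2.
have Ea : a = s + d by rewrite /s /d; lra.
have Et : t = s - d by rewrite /s /d; lra.
have pi0 := pi_gt0 R.
have ss : 0 <= sin s by apply: sin_ge0_pi; rewrite /s; apply/andP; split; lra.
have st : 0 <= sin t by apply: sin_ge0_pi; rewrite t0 tp.
have sa : 0 <= sin a by apply: sin_ge0_pi; rewrite a0 ap.
have cd : 0 <= cos d by apply: cos_ge0_pihalf; rewrite /d; apply/andP; split; lra.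
have -> : cos t - cos a = 2 * (sin s * sin d) 
    by have := congr1 (@cos R) Et; have := congr1 (@cos R) Ea; rewrite cosD cosB => -> ->; ring.
have Ed : a - t = 2 * d by rewrite /d; lra.
rewrite Ed; clearbody s d.
have h1 : sin a <= 2 * (sin s * cos d).
  have : 0 <= sin s * cos d - cos s * sin d by rewrite -sinB -Et.
  by rewrite Ea sinD; lra.
have h2 : `|d| * cos d <= `|sin d|.
  wlog : / 0 <= d.
    have [d0|d0] := leP 0 d; first exact.
    move=> _.
    rewrite -(cosN d) -(normrN d) -(normrN (sin d)) -sinN.
    have nd0 : 0 <= - d by lra.
    rewrite (ger0_norm nd0).
    by apply: le_trans (ler_norm _); apply: mulr_cos_le_sin => //; lra.
  move=> d0; rewrite (ger0_norm d0); apply: le_trans (ler_norm _).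
  by apply: mulr_cos_le_sin => //; lra.
rewrite !normrM !(@ger0_norm _ 2)// (ger0_norm ss).
have h3 := ler_wpM2r (normr_ge0 d) h1.
have h4 := ler_wpM2l ss h2.
lra.
Qed.

(** The first component is the Chebyshev polynomial $T_n$ of the first kind; the second is $U_{n-1}$
    of the second kind, indexed so that it represents $\sin(nt)/\sin t$. The recursion is the
    addition formula for angles. *)
Fixpoint chebTU n : {poly R} * {poly R} :=
  if n is n'.+1 then
    let: (T, U) := chebTU n' in ('X * T - (1 - 'X^2) * U, 'X * U + T)
  else (1, 0).

Definition chebT n := (chebTU n).1.
Definition chebU n := (chebTU n).2.

Lemma chebTS n : chebT n.+1 = 'X * chebT n - (1 - 'X^2) * chebU n.
Proof. by rewrite /chebT /chebU /=; case: (chebTU n). Qed.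

Lemma chebUS n : chebU n.+1 = 'X * chebU n + chebT n.
Proof. by rewrite /chebT /chebU /=; case: (chebTU n). Qed.

Lemma chebTU_cos n t : (chebT n).[cos t] = cos (n%:R * t) /\
  (chebU n).[cos t] * sin t = sin (n%:R * t).
Proof.
elim: n => [|n [IHT IHU]].
  by rewrite mul0r cos0 sin0 /chebT /chebU /= !hornerE.
rewrite -natr1 mulrDl mul1r cosD sinD -IHT -IHU chebTS chebUS !hornerE.
rewrite -sin2cos2; split; ring.
Qed.

(** The two identities need one joint induction: differentiating the recursion of $T$ produces
    $(1-X^2)U'$, which the second identity removes. As identities between polynomials they also hold
    where $\sin t=0$. *)
Lemma deriv_chebTU n : (chebT n)^`() = n%:R *: chebU n /\
  (1 - 'X^2) * (chebU n)^`() = 'X * chebU n - n%:R *: chebT n.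
Proof.
elim: n => [|n [IHT IHU]].
  by rewrite /chebT /chebU /= !poly.derivE !scale0r !mulr0 subr0.
rewrite chebTS chebUS !(poly.derivE, IHT).
rewrite -natr1 -!mul_polyC polyCD in IHT IHU *.
have E : (- ('X *+ 2)) * chebU n + (1 - 'X^2) * (chebU n)^`() =
         (- ('X *+ 2)) * chebU n + ('X * chebU n - n%:R%:P * chebT n).
  by rewrite IHU.
split.
  by rewrite /= expr1 sub0r E; ring.
have -> : (1 - 'X^2) * (1 * chebU n + 'X * (chebU n)^`() + n%:R%:P * chebU n) =
  (1 - 'X^2) * chebU n + 'X * ((1 - 'X^2) * (chebU n)^`())
  + (1 - 'X^2) * n%:R%:P * chebU n :> {poly R} by ring.
by rewrite IHU; ring.
Qed.

Lemma size_chebTU n : (size (chebT n) <= n.+1)%N /\ (size (chebU n) <= n)%N.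
Proof.
elim: n => [|n [IHT IHU]].
  by rewrite /chebT /chebU /= size_poly1 size_poly0.
have sX2 : (size (1 - 'X^2 : {poly R})%R <= 3)%N.
  by rewrite (leq_trans (size_polyD _ _))// size_polyN size_polyXn size_poly1.
rewrite chebTS chebUS; split.
  rewrite (leq_trans (size_polyD _ _))// size_polyN geq_max; apply/andP; split.
    by rewrite (leq_trans (size_polyMleq _ _))// size_polyX.
  rewrite (leq_trans (size_polyMleq _ _))//.
  move: sX2; case: (size _) => [|k] //= hk; rewrite -?addSnnS.
    by rewrite add0n (leq_trans (leq_pred _))// (leq_trans IHU)// -addn2 leq_addr.
  by rewrite -[n.+2]add2n leq_add.
rewrite (leq_trans (size_polyD _ _))// geq_max IHT andbT.
by rewrite (leq_trans (size_polyMleq _ _))// size_polyX.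
Qed.

Definition cheb_angle m j : R := (2 * j + 1)%N%:R * pi / (2 * m)%N%:R.

Lemma cheb_nodeE m j : cheb_node R m j = cos (cheb_angle m j).
Proof. by []. Qed.

Lemma cheb_angleE m j : (0 < m)%N ->
  cheb_angle m j = (j%:R + 2^-1) * pi / m%:R.
Proof.
move=> m0; rewrite /cheb_angle natrD !natrM.
have : m%:R != 0 :> R by rewrite pnatr_eq0 -lt0n.
by move=> ?; field.
Qed.

Lemma mulr_cheb_angle m j : (0 < m)%N ->
  m%:R * cheb_angle m j = j%:R * pi + pi / 2.
Proof.
move=> m0; rewrite cheb_angleE//.
have : m%:R != 0 :> R by rewrite pnatr_eq0 -lt0n.
by move=> ?; field.
Qed.

Lemma cheb_angle_gt0 m j : (0 < m)%N -> 0 < cheb_angle m j.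
Proof.
move=> m0; by rewrite cheb_angleE// divr_gt0 ?ltr0n// mulr_gt0 ?pi_gt0// ltr_wpDl.
Qed.

Lemma cheb_angle_ltpi m j : (j < m)%N -> cheb_angle m j < pi.
Proof.
move=> jm; have m0 : (0 < m)%N by exact: leq_ltn_trans jm.
rewrite cheb_angleE// ltr_pdivrMr ?ltr0n// mulrC ltr_pM2l ?pi_gt0//.
apply: (@lt_le_trans _ _ (j.+1%:R)); last by rewrite ler_nat.
by rewrite [j.+1%:R]mulrS; lra.
Qed.

Lemma ler_cheb_angle m j k : (0 < m)%N -> (j <= k)%N ->
  cheb_angle m j <= cheb_angle m k.
Proof.
move=> m0 jk; rewrite !cheb_angleE// ler_pM2r ?invr_gt0 ?ltr0n//.
by rewrite ler_pM2r ?pi_gt0// lerD2r ler_nat.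
Qed.

Lemma cheb_angle_inj m j k : (0 < m)%N ->
  cheb_angle m j = cheb_angle m k -> j = k.
Proof.
move=> m0 /(congr1 (fun x => m%:R * x)); rewrite !mulr_cheb_angle// => /addIr.
by move/(mulIf (lt0r_neq0 (pi_gt0 R))) => /eqP; rewrite eqr_nat => /eqP.
Qed.

Lemma cheb_node_inj m j k : (j < m)%N -> (k < m)%N ->
  cheb_node R m j = cheb_node R m k -> j = k.
Proof.
move=> jm km; rewrite !cheb_nodeE => /cos_inj E.
have m0 : (0 < m)%N by exact: leq_ltn_trans jm.
apply: (cheb_angle_inj m0); apply: E;
  by rewrite in_itv/= !(ltW (cheb_angle_gt0 _ _), ltW (cheb_angle_ltpi _)).
Qed.

Lemma cos_cheb_angle m j : (0 < m)%N -> cos (m%:R * cheb_angle m j) = 0.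
Proof. by move=> m0; rewrite mulr_cheb_angle// cosDpihalf sin_natpi oppr0. Qed.

Lemma sin_cheb_angle m j : (0 < m)%N ->
  sin (m%:R * cheb_angle m j) = (-1) ^+ j.
Proof. by move=> m0; rewrite mulr_cheb_angle// sinDpihalf cos_natpi. Qed.

(** The nodes are [m] distinct roots and the degree is at most [m]. The constant can stay
    unspecified since it cancels in the quotient defining a basis polynomial. *)
Lemma chebT_factor m : (0 < m)%N -> exists c : R,
  chebT m = c *: \prod_(i < m) ('X - (cheb_node R m i)%:P).
Proof.
move=> m0; pose rs := [seq cheb_node R m (i : 'I_m) | i : 'I_m].
have T0 : chebT m != 0.
  apply/eqP => T0; have [] := chebTU_cos m 0.
  by rewrite T0 mulr0 !cos0 horner0 => /esym/eqP; rewrite oner_eq0.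
have Urs : uniq rs.
  rewrite map_inj_uniq ?enum_uniq// => i j /cheb_node_inj ij.
  by apply: val_inj; apply: ij.
have Ars : all (root (chebT m)) rs.
  apply/allP => _ /mapP[i _ ->]; rewrite /root cheb_nodeE.
  by rewrite (chebTU_cos _ _).1 cos_cheb_angle.
have Srs : size rs = m by rewrite size_map size_enum_ord.
have Sz : size (chebT m) = (size rs).+1.
  apply/eqP; rewrite eqn_leq Srs (size_chebTU m).1 /=.
  by rewrite -[m in (m < _)%N]Srs max_poly_roots.
exists (lead_coef (chebT m)).
rewrite {1}(all_roots_prod_XsubC Sz Ars) ?uniq_rootsE//.
by rewrite /rs big_map big_enum.
Qed.

(** Write $T_m=c(X-x_j)Q$. The basis polynomial is $Q/Q(x_j)$, and differentiating at $x_j$ gives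
    $cQ(x_j)=T_m'(x_j)=mU_{m-1}(x_j)$, where $U_{m-1}(x_j)\sin\theta_j=\sin(m\theta_j)=(-1)^j$. *)
Lemma lagrange_basisE m (j : 'I_m) t : cos t != cheb_node R m j ->
  lagrange_basis j (cos t) = cos (m%:R * t) * (-1) ^+ j *
    (sin (cheb_angle m j) / (m%:R * (cos t - cheb_node R m j))).
Proof.
move=> tj; have m0 : (0 < m)%N by exact: leq_ltn_trans (ltn_ord j).
have [c Ec] := chebT_factor m0.
pose Q := \prod_(i < m | i != j) ('X - (cheb_node R m i)%:P).
have EQ : chebT m = c *: (('X - (cheb_node R m j)%:P) * Q).
  by rewrite Ec (bigD1 j).
have HQ x : Q.[x] = \prod_(i < m | i != j) (x - cheb_node R m i).
  by rewrite horner_prod; apply: eq_bigr => i _; rewrite !hornerE.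
have Tt : c * (cos t - cheb_node R m j) * Q.[cos t] = cos (m%:R * t).
  by rewrite -(chebTU_cos _ _).1 EQ hornerZ hornerM hornerXsubC mulrA.
have Td : c * Q.[cheb_node R m j] = m%:R * (chebU m).[cheb_node R m j].
  have := congr1 (fun p => p^`().[cheb_node R m j]) EQ.
  rewrite (deriv_chebTU m).1 derivZ derivM derivXsubC mul1r !hornerE.
  by rewrite subrr mul0r addr0 => ->.
have Us : (chebU m).[cheb_node R m j] * sin (cheb_angle m j) = (-1) ^+ j.
  by rewrite (chebTU_cos _ _).2 sin_cheb_angle.
have Qj0 : Q.[cheb_node R m j] != 0.
  rewrite HQ; apply/prodf_neq0 => i ij; rewrite subr_eq0.
  by apply: contra_neq ij => /(cheb_node_inj (ltn_ord _) (ltn_ord _))/val_inj.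
have sgn2 : (-1) ^+ j * (-1) ^+ j = 1 :> R by rewrite -expr2 sqrr_sign.
have sgn0 : (-1) ^+ j != 0 :> R by rewrite signr_eq0.
have m0' : m%:R != 0 :> R by rewrite pnatr_eq0 -lt0n.
have U0 : (chebU m).[cheb_node R m j] != 0.
  by apply: contra_neq sgn0 => U0; rewrite -Us U0 mul0r.
have c0 : c != 0.
  by apply/eqP => c0; move/eqP: Td; rewrite c0 mul0r eq_sym mulf_eq0 (negPf m0') (negPf U0).
have Es : sin (cheb_angle m j) = (-1) ^+ j / (chebU m).[cheb_node R m j].
  by rewrite -Us mulrC mulKf.
have tj' : cos t - cheb_node R m j != 0 by rewrite subr_eq0.
rewrite /lagrange_basis big_split /= -HQ.
rewrite prodfV -HQ Es -Tt.
have -> : Q.[cheb_node R m j] = m%:R * (chebU m).[cheb_node R m j] / c.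
  by rewrite -Td mulrC mulKf.
transitivity (c * Q.[cos t] * ((-1) ^+ j * (-1) ^+ j) /
   (m%:R * (chebU m).[cheb_node R m j])).
  by rewrite sgn2; field; rewrite ?c0 ?tj' ?U0 ?m0'.
by field; rewrite ?c0 ?tj' ?U0 ?m0'.
Qed.

Lemma lagrange_basis_node m (i j : 'I_m) :
  lagrange_basis j (cheb_node R m i) = (i == j)%:R.
Proof.
rewrite /lagrange_basis; have [->|ij] := eqVneq i j; last first.
  by rewrite (bigD1 i)//= subrr mul0r mul0r.
apply: big1 => k kj; rewrite divff// subr_eq0.
by apply: contra_neq kj => /(cheb_node_inj (ltn_ord _) (ltn_ord _))/val_inj.
Qed.

(** The difference to 1 is a polynomial of degree below [m] that vanishes at the [m] distinct
    nodes. *)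
Lemma sum_lagrange_basis m x : (0 < m)%N ->
  \sum_(j < m) lagrange_basis j x = 1 :> R.
Proof.
move=> m0.
pose L (j : 'I_m) : {poly R} := \prod_(i < m | i != j)
  (((cheb_node R m j - cheb_node R m i)^-1) *: ('X - (cheb_node R m i)%:P)).
have LE (j : 'I_m) y : (L j).[y] = lagrange_basis j y.
  by rewrite horner_prod; apply: eq_bigr => i _; rewrite !hornerE mulrC.
pose p := \sum_(j < m) L j - 1.
have pE y : p.[y] = \sum_(j < m) lagrange_basis j y - 1.
  by rewrite !hornerE horner_sum; congr (_ - _); apply: eq_bigr => j _; exact: LE.
suff : p = 0.
  by move/(congr1 (fun q => q.[x])); rewrite pE horner0 => /eqP; rewrite subr_eq0 => /eqP.
pose rs := [seq cheb_node R m (i : 'I_m) | i : 'I_m].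
have Urs : uniq rs.
  rewrite map_inj_uniq ?enum_uniq// => i j /cheb_node_inj ij.
  by apply: val_inj; apply: ij.
have Srs : size rs = m by rewrite size_map size_enum_ord.
have Ars : all (root p) rs.
  apply/allP => _ /mapP[i _ ->]; rewrite /root pE (bigD1 i)//= lagrange_basis_node eqxx.
  by rewrite big1 ?addr0 ?subrr// => j ji; rewrite lagrange_basis_node eq_sym (negPf ji).
apply: contraTeq isT => p0.
have := max_poly_roots p0 Ars Urs; rewrite Srs ltnNge.
suff -> : (size p <= m)%N by [].
rewrite (leq_trans (size_polyD _ _))// size_polyN size_poly1 geq_max m0 andbT.
apply: (leq_trans (size_sum _ _ _)); apply/bigmax_leqP => j _.
rewrite /L; apply: (leq_trans (size_prod_leq _ _)).
rewrite leq_subLR.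
apply: (@leq_trans (\sum_(i < m | i != j) 2).+1).
  by rewrite ltnS; apply: leq_sum => i _; rewrite (leq_trans (size_scale_leq _ _))// size_XsubC.
rewrite sum_nat_const muln2 -addnn -addnS leq_add2l.
by rewrite cardC1 card_ord prednK.
Qed.

Lemma alternating_sum_bound n (u : nat -> R) :
  (forall i, (i < n)%N -> 0 <= u i) ->
  (forall i, (i.+1 < n)%N -> u i.+1 <= u i) ->
  0 <= \sum_(i < n) (-1) ^+ i * u i <= (if n is 0 then 0 else u 0%N).
Proof.
elim: n u => [|n IH] u u0 ud; first by rewrite big_ord0 lexx.
rewrite big_ord_recl expr0 mul1r.
under eq_bigr do rewrite lift0 exprS mulN1r mulNr.
rewrite sumrN.
have /andP[h1 h2] := IH (fun i => u i.+1) (fun i => u0 i.+1) (fun i => ud i.+1).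
rewrite gerBl h1 andbT subr_ge0; apply: le_trans h2 _.
by case: n u0 ud {IH h1} => [|n] u0 ud; [exact: u0|exact: ud].
Qed.

Lemma alternating_sum_norm n (u : nat -> R) V : 0 <= V ->
  (forall i, (i < n)%N -> 0 <= u i <= V) ->
  (forall i, (i.+1 < n)%N -> u i.+1 <= u i) ->
  `|\sum_(i < n) (-1) ^+ i * u i| <= V.
Proof.
move=> V0 u0 ud.
have /andP[h1 h2] := alternating_sum_bound (fun i h => (andP (u0 i h)).1) ud.
rewrite ger0_norm//; apply: le_trans h2 _; case: n u0 {ud h1} => // n u0.
by case/andP: (u0 0%N isT).
Qed.

(** The factors [v i * (g i - c)] need not be monotone, whereas [v i * g i] and [v i] are; the sum
    is split accordingly, at the price of the factor 2. *)
Lemma alternating_sum_diff n (v g : nat -> R) V c : 0 <= V -> 0 <= c <= 1 ->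
  (forall i, (i < n)%N -> 0 <= v i <= V) ->
  (forall i, (i.+1 < n)%N -> v i.+1 <= v i) ->
  (forall i, (i < n)%N -> 0 <= g i <= 1) ->
  (forall i, (i.+1 < n)%N -> g i.+1 <= g i) ->
  `|\sum_(i < n) (-1) ^+ i * (v i * (g i - c))| <= 2 * V.
Proof.
move=> V0 /andP[c0 c1] v0 vd g0 gd.
have -> : \sum_(i < n) (-1) ^+ i * (v i * (g i - c)) =
    \sum_(i < n) (-1) ^+ i * (v i * g i) - c * \sum_(i < n) (-1) ^+ i * v i.
  by rewrite mulr_sumr -sumrB; apply: eq_bigr => i _; ring.
apply: le_trans (ler_normB _ _) _; rewrite mulr2n mulrDl mul1r.
apply: lerD.
  apply: (@alternating_sum_norm n (fun i => v i * g i)) => // i ni.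
    have /andP[a1 a2] := v0 _ ni; have /andP[b1 b2] := g0 _ ni.
    by rewrite mulr_ge0//= -[leRHS]mulr1 ler_pM.
  have /andP[a1 _] := v0 _ ni; have /andP[b1 _] := g0 _ ni.
  by rewrite ler_pM// ?vd ?gd.
rewrite normrM (ger0_norm c0) -[leRHS]mul1r ler_pM//.
exact: alternating_sum_norm.
Qed.

Lemma lagrange_basis_far m (j : 'I_m) t : 0 <= t <= pi ->
  t != cheb_angle m j ->
  `|sin (cheb_angle m j) / (m%:R * (cos t - cheb_node R m j))| <=
  2 / (m%:R * `|cheb_angle m j - t|).
Proof.
move=> tpi tj; have m0 : (0 < m)%N by exact: leq_ltn_trans (ltn_ord j).
have api : 0 <= cheb_angle m j <= pi.
  by rewrite (ltW (cheb_angle_gt0 _ _))// (ltW (cheb_angle_ltpi _)).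
have m0' : 0 < m%:R :> R by rewrite ltr0n.
rewrite normrM normfV normrM (gtr0_norm m0').
rewrite ger0_norm ?sin_ge0_pi//.
have h := sin_mul_dist_le tpi api.
have d0 : 0 < `|cheb_angle m j - t| by rewrite normr_gt0 subr_eq0 eq_sym.
have c0 : 0 < `|cos t - cheb_node R m j|.
  rewrite normr_gt0 subr_eq0 cheb_nodeE; apply: contra_neq tj.
  by move/cos_inj => ->//; rewrite in_itv.
rewrite ler_pdivrMr ?mulr_gt0// -mulrA mulrC -mulrA ler_pdivlMl ?mulr_gt0//.
rewrite -[in leRHS]mulrA -[leLHS]mulrA ler_pM2l//.
by rewrite [leLHS]mulrC [leRHS]mulrC.
Qed.

(** Since $\cos(m\theta_j)=0$, the numerator satisfies $|\cos(mt)|\le m|\theta_j-t|$, which cancels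
    the denominator in [lagrange_basis_far]. *)
Lemma lagrange_basis_le2 m (j : 'I_m) t : 0 <= t <= pi ->
  `|lagrange_basis j (cos t)| <= 2.
Proof.
move=> tpi; have m0 : (0 < m)%N by exact: leq_ltn_trans (ltn_ord j).
have api : 0 <= cheb_angle m j <= pi.
  by rewrite (ltW (cheb_angle_gt0 _ _))// (ltW (cheb_angle_ltpi _)).
have m0' : 0 < m%:R :> R by rewrite ltr0n.
have [->|tj] := eqVneq t (cheb_angle m j).
  by rewrite -cheb_nodeE lagrange_basis_node eqxx normr1; lra.
have d0 : 0 < `|cheb_angle m j - t| by rewrite normr_gt0 subr_eq0 eq_sym.
rewrite lagrange_basisE; last first.
  by rewrite cheb_nodeE; apply: contra_neq tj => /cos_inj ->//; rewrite in_itv.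
rewrite 2!normrM normr_sign mulr1.
have h1 : `|cos (m%:R * t)| <= m%:R * `|cheb_angle m j - t|.
  rewrite -[cos _]subr0 -(cos_cheb_angle j m0); apply: le_trans (cos_dist _ _) _.
  by rewrite -mulrBr normrM gtr0_norm// distrC.
apply: le_trans (ler_pM (normr_ge0 _) (normr_ge0 _) h1 (lagrange_basis_far tpi tj)) _.
by rewrite mulrC divfK// gt_eqF// mulr_gt0.
Qed.

(* At a fixed point the basis polynomials alternate in sign on either side of it
   and decrease in size away from it. Since [g] is monotone, the alternating sum
   is bounded by its first term, whence no Lebesgue constant [log m] appears. *)
Lemma lagrange_right_tail m (b : nat) (g : nat -> R) c t V : 0 <= t <= pi ->
  0 <= V -> 0 <= c <= 1 -> (0 < m)%N ->
  (forall j, (b <= j < m)%N -> t < cheb_angle m j /\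
     2 / (m%:R * (cheb_angle m j - t)) <= V) ->
  (forall j, (j < m)%N -> 0 <= g j <= 1) ->
  (forall j, (j.+1 < m)%N -> g j.+1 <= g j) ->
  `|\sum_(j < m | (b <= j)%N) (g j - c) * lagrange_basis j (cos t)| <= 2 * V.
Proof.
move=> tpi V0 c01 m0 ht g0 gd.
have m0' : 0 < m%:R :> R by rewrite ltr0n.
have api j : (j < m)%N -> 0 <= cheb_angle m j <= pi.
  by move=> jm; rewrite (ltW (cheb_angle_gt0 _ _))// (ltW (cheb_angle_ltpi _)).
pose v j := sin (cheb_angle m j) / (m%:R * (cos t - cheb_node R m j)).
have ct j : (b <= j < m)%N -> 0 < cos t - cheb_node R m j.
  move=> bj; have [tj _] := ht _ bj; case/andP: bj => _ jm.
  by rewrite subr_gt0 cheb_nodeE ltr_cos// ?in_itv//= api.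
have v0 j : (b <= j < m)%N -> 0 <= v j <= V.
  move=> bj; have c0 := ct _ bj; have [tj hV] := ht _ bj.
  case/andP: (bj) => _ jm.
  have v0 : 0 <= v j.
    by apply: divr_ge0; [exact/sin_ge0_pi/api|apply: mulr_ge0; exact: ltW].
  rewrite v0 /=; apply: le_trans hV; rewrite -(ger0_norm v0).
  have := @lagrange_basis_far m (Ordinal jm) t tpi (negbT (lt_eqF tj)).
  by rewrite [in X in _ <= X](@gtr0_norm _ (_ - t)) ?subr_gt0.
have vd j : (b <= j)%N -> (j.+1 < m)%N -> v j.+1 <= v j.
  move=> bj jm; have c0 : 0 < cos t - cheb_node R m j by rewrite ct// bj ltnW.
  have c1 : 0 < cos t - cheb_node R m j.+1 by rewrite ct// jm (leq_trans bj).
  rewrite /v !invfM !mulrA ![_ / m%:R]mulrC -!mulrA ler_pM2l ?invr_gt0//.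
  rewrite ler_pdivrMr// mulrAC ler_pdivlMr// !cheb_nodeE.
  apply: sin_cos_cross; [|exact: ler_cheb_angle|]; first by case/andP: (api j (ltnW jm)).
  by case/andP: (api _ jm).
have -> : \sum_(j < m | (b <= j)%N) (g j - c) * lagrange_basis j (cos t) =
    cos (m%:R * t) * (-1) ^+ b *
    \sum_(i < m - b) (-1) ^+ i * (v (i + b)%N * (g (i + b)%N - c)).
  transitivity (\sum_(j < m | (b <= j)%N)
     cos (m%:R * t) * (-1) ^+ j * (v j * (g j - c))).
    apply: eq_bigr => j bj; rewrite lagrange_basisE.
      by rewrite -/(v j) mulrC !mulrA.
    by rewrite -subr_eq0 gt_eqF// ct// bj /=.
  rewrite -(big_geq_mkord _ _ xpredT (fun j => cos (m%:R * t) * (-1) ^+ j * (v j * (g j - c)))).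
  rewrite -{1}[b]add0n big_addn big_mkord mulr_sumr; apply: eq_bigr => i _.
  by rewrite exprD; ring.
rewrite 2!normrM normr_sign mulr1 -[leRHS]mul1r ler_pM// ?cos_max//.
have ib i : (i < m - b)%N -> (b <= i + b < m)%N by rewrite ltn_subRL addnC leq_addl.
apply: (@alternating_sum_diff _ (fun i => v (i + b)%N) (fun i => g (i + b)%N)) => // i im.
- exact/v0/ib.
- by rewrite addSn vd ?leq_addl// -addSn; case/andP: (ib _ im).
- by apply: g0; case/andP: (ib _ im).
- by apply: gd; rewrite -addSn; case/andP: (ib _ im).
Qed.

(** Read from the point outwards the indices decrease, so [g] increases; the alternating bound is
    applied to [1 - g] and [1 - c] instead. This change of sign also absorbs the negative sign of
    [cos t - cheb_node R m j]. *)
Lemma lagrange_left_tail m (b : nat) (g : nat -> R) c t V : 0 <= t <= pi ->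
  0 <= V -> 0 <= c <= 1 -> (b <= m)%N -> (0 < m)%N ->
  (forall j, (j < b)%N -> cheb_angle m j < t /\
     2 / (m%:R * (t - cheb_angle m j)) <= V) ->
  (forall j, (j < m)%N -> 0 <= g j <= 1) ->
  (forall j, (j.+1 < m)%N -> g j.+1 <= g j) ->
  `|\sum_(j < m | (j < b)%N) (g j - c) * lagrange_basis j (cos t)| <= 2 * V.
Proof.
move=> tpi V0 c01 bm m0 ht g0 gd.
have m0' : 0 < m%:R :> R by rewrite ltr0n.
have api j : (j < m)%N -> 0 <= cheb_angle m j <= pi.
  by move=> jm; rewrite (ltW (cheb_angle_gt0 _ _))// (ltW (cheb_angle_ltpi _)).
pose v j := sin (cheb_angle m j) / (m%:R * (cheb_node R m j - cos t)).
have ct j : (j < b)%N -> 0 < cheb_node R m j - cos t.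
  move=> bj; have [tj _] := ht _ bj.
  by rewrite subr_gt0 cheb_nodeE ltr_cos// ?in_itv//= api// (leq_trans bj).
have v0 j : (j < b)%N -> 0 <= v j <= V.
  move=> bj; have c0 := ct _ bj; have [tj hV] := ht _ bj.
  have jm := leq_trans bj bm.
  have v0 : 0 <= v j.
    by apply: divr_ge0; [exact/sin_ge0_pi/api|apply: mulr_ge0; exact: ltW].
  rewrite v0 /=; apply: le_trans hV; rewrite -(ger0_norm v0).
  have := @lagrange_basis_far m (Ordinal jm) t tpi (negbT (gt_eqF tj)).
  rewrite distrC [in X in _ <= X](@gtr0_norm _ (t - _)) ?subr_gt0//.
  by rewrite -[cos t - _]opprB mulrN invrN mulrN normrN.
have vd j : (j.+1 < b)%N -> v j <= v j.+1.
  move=> bj; have c0 : 0 < cheb_node R m j - cos t by rewrite ct// ltnW.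
  have c1 : 0 < cheb_node R m j.+1 - cos t by rewrite ct.
  have jm := leq_trans bj bm.
  rewrite /v !invfM !mulrA ![_ / m%:R]mulrC -!mulrA ler_pM2l ?invr_gt0//.
  rewrite ler_pdivrMr// mulrAC ler_pdivlMr// !cheb_nodeE.
  rewrite -[_ - cos t]opprB -[X in _ <= _ * X]opprB !mulrN lerN2.
  apply: sin_cos_cross; [|exact: ler_cheb_angle|]; first by case/andP: (api j (ltnW jm)).
  by case/andP: (api _ jm).
have Er (i : 'I_b) : (-1) ^+ (b - i.+1) = (-1) ^+ b.-1 * (-1) ^+ i :> R.
  have -> : b.-1 = (b - i.+1 + i)%N by have := ltn_ord i; lia.
  by rewrite exprD -mulrA -expr2 sqrr_sign mulr1.
have -> : \sum_(j < m | (j < b)%N) (g j - c) * lagrange_basis j (cos t) =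
    cos (m%:R * t) * (-1) ^+ b.-1 *
    \sum_(i < b) (-1) ^+ i * (v (b - i.+1)%N * (1 - g (b - i.+1)%N - (1 - c))).
  transitivity (\sum_(j < m | (j < b)%N)
     - (cos (m%:R * t) * (-1) ^+ j * (v j * (g j - c)))).
    apply: eq_bigr => j bj; rewrite lagrange_basisE; last first.
      by rewrite -subr_eq0 -oppr_eq0 opprB gt_eqF// ct.
    by rewrite -[cos t - _]opprB mulrN invrN /v; ring.
  rewrite -(big_ord_widen _ (fun j => - (cos (m%:R * t) * (-1) ^+ j * (v j * (g j - c)))) bm).
  rewrite (reindex_inj rev_ord_inj) /= mulr_sumr; apply: eq_bigr => i _.
  by rewrite Er; ring.
rewrite 2!normrM normr_sign mulr1 -[leRHS]mul1r ler_pM// ?cos_max//.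
case/andP: c01 => c0 c1.
apply: (@alternating_sum_diff _ (fun i => v (b - i.+1)%N) (fun i => 1 - g (b - i.+1)%N)) => //.
- by apply/andP; split; lra.
- by move=> i ib; apply: v0; lia.
- move=> i ib; have -> : (b - i.+1 = (b - i.+2).+1)%N by lia.
  by apply: vd; lia.
- move=> i ib; have /g0/andP[] : (b - i.+1 < m)%N by lia.
  by move=> ? ?; apply/andP; split; lra.
- move=> i ib; have -> : (b - i.+1 = (b - i.+2).+1)%N by lia.
  by rewrite lerD2l lerN2; apply: gd; lia.
Qed.

(** Each tail contributes [2 / K]. There are at most [2 * K + 1] middle terms, each at most 2 times
    the error at the node plus the variation of [F] over an angle of at most [(K + 1) * pi / m]. *)
Lemma lagrange_monotone_approx m K (g : nat -> R) (F : R -> R) e C t :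
  (0 < m)%N -> (0 < K)%N -> 0 <= t <= pi ->
  (forall j, (j < m)%N -> 0 <= g j <= 1) ->
  (forall j, (j.+1 < m)%N -> g j.+1 <= g j) ->
  0 <= F (cos t) <= 1 -> 0 <= C ->
  (forall x y, `|F x - F y| <= C * `|x - y|) ->
  (forall j, (j < m)%N -> `|g j - F (cheb_node R m j)| <= e) ->
  `|\sum_(j < m) g j * lagrange_basis j (cos t) - F (cos t)| <=
  4 / K%:R + (2 * K + 1)%:R * 2 * (e + C * (K%:R + 1) * pi / m%:R).
Proof.
move=> m0 K0 tpi g0 gd F01 C0 FL ge.
have m0' : 0 < m%:R :> R by rewrite ltr0n.
have K0' : 0 < K%:R :> R by rewrite ltr0n.
have p0 := pi_gt0 R.
(* The angle in units of the node spacing [pi / m]: node [j] sits at [j + 1/2], so that index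
   distances from [q] control angular distances. *)
pose u := t * m%:R / pi.
have u0 : 0 <= u by case/andP: tpi => t0 _; rewrite /u !(mulr_ge0, invr_ge0)// ltW.
pose q := Num.truncn u.
have /andP[q1 q2] := truncn_itv u0.
rewrite -/q in q1 q2.
have Et : t = u * pi / m%:R by rewrite /u divfK ?mulfK// gt_eqF.
have Ea j : cheb_angle m j - t = (j%:R + 2^-1 - u) * pi / m%:R.
  by rewrite cheb_angleE// {1}Et; ring.
have qS : u < q%:R + 1 by rewrite natr1.
have e0 : 0 <= e by apply: le_trans (ge 0%N m0).
clearbody q; clearbody u.
have -> : \sum_(j < m) g j * lagrange_basis j (cos t) - F (cos t) =
    \sum_(j < m) (g j - F (cos t)) * lagrange_basis j (cos t).
  under [RHS]eq_bigr do rewrite mulrBl.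
  by rewrite sumrB -mulr_sumr sum_lagrange_basis// mulr1.
rewrite (bigID (fun j : 'I_m => (q + K < j)%N)) /=.
rewrite [X in _ + X](bigID (fun j : 'I_m => (j < q - K)%N)) /=.
(* The tail bound [V] is [1 / K]: at a distance of [x >= K] spacings the weight is at most
   [2 / (x * pi)], and [pi >= 2]. *)
have VK (x : R) : K%:R <= x -> 2 / (m%:R * (x * pi / m%:R)) <= K%:R^-1.
  move=> Kx; have x0 : 0 < x by apply: lt_le_trans Kx.
  have -> : m%:R * (x * pi / m%:R) = x * pi by field; rewrite gt_eqF.
  rewrite ler_pdivrMr ?mulr_gt0// ler_pdivlMl//.
  by rewrite ler_pM ?pi_ge2 // ltW.
rewrite (_ : 4 / K%:R = 2 * K%:R^-1 + 2 * K%:R^-1 :> R); last by ring.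
rewrite -[leRHS]addrA; apply: le_trans (ler_normD _ _) _; apply: lerD.
  apply: lagrange_right_tail => //.
  move=> j /andP[qj jm]; rewrite -subr_gt0 Ea.
  have h : K%:R <= j%:R + 2^-1 - u.
    have : ((q + K).+1%:R : R) <= j%:R by rewrite ler_nat.
    by rewrite -natr1 natrD; lra.
  by split; [rewrite !(mulr_gt0, invr_gt0)//; exact: lt_le_trans h|exact: VK].
apply: le_trans (ler_normD _ _) _; apply: lerD.
  rewrite (eq_bigl (fun j : 'I_m => (j < minn m (q - K))%N)); last first.
    move=> j; rewrite leq_min ltn_ord /= -leqNgt andb_idl//.
    by move: (nat_of_ord j) => i; clear; lia.
  apply: lagrange_left_tail => //; first exact: geq_minl.
  move=> j; rewrite leq_min => /andP[jm jq]; rewrite -subr_gt0 -opprB Ea -!mulNr.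
  have h : K%:R <= - (j%:R + 2^-1 - u).
    have : ((j + K).+1%:R : R) <= q%:R by rewrite ler_nat; move: jq; clear; lia.
    by rewrite -natr1 natrD; lra.
  by split; [rewrite !(mulr_gt0, invr_gt0)//; exact: lt_le_trans h|exact: VK].
set D := e + _.
have D0 : 0 <= D.
  by rewrite addr_ge0// divr_ge0// ?mulr_ge0 ?(ltW p0)// ltW// ltr_wpDr.
apply: le_trans (ler_norm_sum _ _ _) _.
apply: (@le_trans _ _ (\sum_(i < m | ~~ (q + K < i)%N && ~~ (i < q - K)%N) (2 * D))).
  apply: ler_sum => j /andP[]; rewrite -!leqNgt => j1 j2.
  rewrite normrM mulrC; apply: ler_pM => //; first exact: lagrange_basis_le2.
  have -> : g j - F (cos t) = (g j - F (cheb_node R m j)) +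
     (F (cheb_node R m j) - F (cos t)) by ring.
  apply: le_trans (ler_normD _ _) _; apply: lerD; first exact: ge.
  apply: le_trans (FL _ _) _; rewrite -!mulrA ler_wpM2l//.
  rewrite cheb_nodeE; apply: le_trans (cos_dist _ _) _; rewrite Ea -mulrA normrM.
  rewrite (ger0_norm (_ : 0 <= pi / m%:R)); last by rewrite divr_ge0 ?ltW.
  rewrite ler_wpM2r//; first by rewrite divr_ge0 ?ltW.
  have h1 : (j%:R : R) <= q%:R + K%:R by rewrite -natrD ler_nat.
  have h2 : q%:R <= j%:R + K%:R :> R by rewrite -natrD ler_nat; move: j2; clear; lia.
  by rewrite ler_norml; apply/andP; split; lra.
rewrite -mulrA (eq_bigr (fun=> 1%:R * (2 * D))); last by move=> *; rewrite mul1r.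
rewrite -mulr_suml -natr_sum ler_wpM2r ?mulr_ge0// ler_nat.
rewrite (eq_bigl (fun j : 'I_m => ((q - K <= j)%N && (j < minn m (q + K).+1)%N))); last first.
  by move=> j; rewrite leq_min ltn_ord /= ltnS -!leqNgt andbC.
rewrite -(big_ord_widen_cond _ (fun j => q - K <= j)%N (fun=> 1%N)) ?geq_minl//.
rewrite -(big_geq_mkord _ _ xpredT (fun=> 1%N)) sum_nat_const_nat muln1.
by clear; lia.
Qed.

End Chebyshev.

(** * Moments of normal laws *)

(** By dominated convergence it is enough to integrate over [[- n.+1%:R, n.+1%:R]], where the
    fundamental theorem leaves boundary values that vanish. This plays the role of integration by
    parts for the Gaussian moments. *)
Lemma integral_deriv_line (R : realType) (G g : R -> R) :
  (forall x : R, is_derive x (1 : R) G (g x)) -> continuous g ->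
  (@lebesgue_measure R).-integrable setT (EFin \o g) ->
  G n%:R @[n --> \oo] --> (0 : R) -> G (- n%:R) @[n --> \oo] --> (0 : R) ->
  (\int[@lebesgue_measure R]_x (g x)%:E = 0)%E.
Proof.
move=> dG cg ig Gy GNy.
set mu := @lebesgue_measure R.
pose f n : R -> \bar R := (EFin \o g) \_ `[- n.+1%:R, n.+1%:R].
have mg : measurable_fun setT (EFin \o g) by case/integrableP: ig.
have mf n : measurable_fun setT (f n).
  by apply/(measurable_restrictT _ _).1 => //; exact: measurable_funTS.
have [] := @dominated_convergence _ _ R mu setT measurableT f (EFin \o g)
  (abse \o (EFin \o g)) mf mg.
- apply: aeW => /= x _.
  apply: cvg_near_cst; exists (Num.truncn `|x|).+1 => // n /= xn.
  rewrite /f patchE ifT// inE/= in_itv/= -ler_norml.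
  have xl : `|x| < (Num.truncn `|x|).+1%:R.
    by have /andP[] := truncn_itv (normr_ge0 x).
  by rewrite (le_trans (ltW xl))// ler_nat ltnW.
- exact: integrable_abse.
- apply: aeW => /= x n _; rewrite /f patchE; case: ifP => // _.
  by rewrite abse0.
move=> _ _ L.
suff L0 : (\int[mu]_x f n x)%E @[n --> \oo] --> 0%E.
  exact: cvg_unique L L0.
have E n : (\int[mu]_x f n x = (G n.+1%:R - G (- n.+1%:R))%:E)%E.
  rewrite /f -integral_mkcond /= (@continuous_FTC2 _ _ G)//.
  - by rewrite gtrN.
  - exact/continuous_subspaceT.
  - have cG x : {for x, continuous G}.
      by apply: differentiable_continuous; apply/derivable1_diffP; case: (dG x).
    split.
    + by move=> x _; case: (dG x).
    + exact/cvg_at_right_filter/cG.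
    + exact/cvg_at_left_filter/cG.
  - by move=> x _; rewrite derive1E; case: (dG x).
under eq_fun do rewrite E.
apply: cvg_EFin; first exact: nearW.
rewrite -[X in _ --> X](subrr (0 : R)).
by apply: cvgB; [rewrite (cvg_shiftS (fun n => G n%:R))|
  rewrite (cvg_shiftS (fun n => G (- n%:R)))].
Qed.

Section normal_moments.
Variable R : realType.
Implicit Types (m s x z : R) (k : nat).
Local Notation mu := (@lebesgue_measure R).

Definition normal_moment_fun m s k (x : R) : R := (x - m) ^+ k * normal_pdf m s x.
Local Notation g := normal_moment_fun.

Lemma is_derive_normal_pdf m s x : s != 0 ->
  is_derive x (1 : R) (normal_pdf m s) (- ((x - m) / s ^+ 2) * normal_pdf m s x).
Proof.
move=> s0; rewrite normal_pdfE// /normal_fun.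
apply: is_derive_eq; rewrite /GRing.scale /=.
by field.
Qed.

Lemma is_derive_normal_moment_fun m s k x : s != 0 ->
  is_derive x (1 : R) (g m s k)
    (k%:R * g m s k.-1 x - g m s k.+1 x / s ^+ 2).
Proof.
move=> s0; rewrite /g.
have := is_derive_normal_pdf m x s0 => dp.
have dX : is_derive x (1 : R) (fun y : R => (y - m) ^+ k) (k%:R * (x - m) ^+ k.-1).
  have dB : is_derive x (1 : R) (fun y : R => y - m) 1.
    by apply: is_derive_eq; rewrite subr0.
  have := @is_deriveX _ _ (fun y : R => y - m) k x 1 1 dB.
  by rewrite /GRing.scale /= mulr1 exprfctE.
have := @is_deriveM _ _ _ _ x 1 _ _ dX dp.
move/is_derive_eq; apply.
rewrite /GRing.scale /= [_ ^+ k.+1]exprS.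
by move: ((x - m) ^+ k.-1) (k%:R : R) ((x - m) ^+ k) => a b c; field.
Qed.

Lemma continuous_normal_moment_fun m s k : s != 0 -> continuous (g m s k).
Proof.
move=> s0 x; apply: differentiable_continuous; apply/derivable1_diffP.
by case: (is_derive_normal_moment_fun m k x s0).
Qed.

(** Half of the Gaussian exponent pays for the power: $|z|^k\le1+|z|^{2k}$, and $y^k\le k!\,e^y$
    with $y=z^2/(4s^2)$. The other half is a normal density with $s$ replaced by $\sqrt2 s$, up to a
    constant. *)
Lemma normr_expr_le_expR z s k : s != 0 ->
  `|z| ^+ k <= (1 + (4 * s ^+ 2) ^+ k * k`!%:R) * expR (z ^+ 2 / (4 * s ^+ 2)).
Proof.
move=> s0; have s2 : 0 < s ^+ 2 by rewrite exprn_even_gt0.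
set y := z ^+ 2 / _; have y0 : 0 <= y by rewrite divr_ge0 ?sqr_ge0// mulr_ge0// ltW.
have h1 : `|z| ^+ k <= 1 + (4 * s ^+ 2) ^+ k * y ^+ k.
  have -> : (4 * s ^+ 2) ^+ k * y ^+ k = (`|z| ^+ k) ^+ 2.
    rewrite -exprMn mulrC divfK ?mulf_neq0// ?pnatr_eq0//.
    by rewrite -[z ^+ 2]real_normK ?num_real// exprAC.
  by have := sqr_ge0 (`|z| ^+ k - 1); have := sqr_ge0 (`|z| ^+ k); nra.
apply: le_trans h1 _.
have h2 : y ^+ k <= k`!%:R * expR y.
  case: k => [|k]; first by rewrite expr0 fact0 mul1r -[leLHS]expR0 ler_expR.
  have := expR_ge1Dxn k y0 => h; rewrite -ler_pdivrMl ?ltr0n ?fact_gt0//.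
  by rewrite mulrC; apply: le_trans h; rewrite lerDr.
rewrite [leRHS]mulrDl mul1r -mulrA; apply: lerD.
  by rewrite -expR0 ler_expR.
by rewrite ler_wpM2l// exprn_ge0// mulr_ge0// ltW.
Qed.

Lemma normal_moment_fun_dominated m s k : s != 0 -> exists C : R,
  forall x, `|g m s k x| <= C * normal_pdf m (Num.sqrt 2 * s) x.
Proof.
move=> s0; have s2 : 0 < s ^+ 2 by rewrite exprn_even_gt0.
have t0 : Num.sqrt 2 * s != 0 by rewrite mulf_neq0// gt_eqF// sqrtr_gt0.
have t2 : (Num.sqrt 2 * s) ^+ 2 = 2 * s ^+ 2 by rewrite exprMn sqr_sqrtr.
have pk := normal_peak_gt0 s0; have pk' := normal_peak_gt0 t0.
pose D := (1 + (4 * s ^+ 2) ^+ k * k`!%:R).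
exists (D * normal_peak s / normal_peak (Num.sqrt 2 * s)) => x.
rewrite /g (normal_pdfE _ s0) (normal_pdfE _ t0).
rewrite normrM normrX (ger0_norm (mulr_ge0 _ _)) ?normal_fun_ge0 ?normal_peak_ge0//.
rewrite mulrCA -!mulrA mulrA [leRHS]mulrCA [D * _]mulrC -mulrA -mulrA ler_pM2l//.
rewrite [leRHS](_ : _ = D * normal_fun m (Num.sqrt 2 * s) x); last first.
  by field; rewrite gt_eqF.
have -> : normal_fun m (Num.sqrt 2 * s) x =
    expR ((x - m) ^+ 2 / (4 * s ^+ 2)) * normal_fun m s x.
  rewrite /normal_fun -expRD t2; congr expR; field; exact: s0.
by rewrite mulrA ler_wpM2r ?normal_fun_ge0// normr_expr_le_expR.
Qed.

Lemma integrable_normal_moment_fun m s k : s != 0 ->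
  mu.-integrable setT (EFin \o g m s k).
Proof.
move=> s0; have [C HC] := normal_moment_fun_dominated m k s0.
apply: (@le_integrable _ _ _ mu setT measurableT (EFin \o g m s k)
  (fun x => (C * normal_pdf m (Num.sqrt 2 * s) x)%:E)).
- apply/measurable_EFinP; apply: measurable_funM; last exact: measurable_normal_pdf.
  by apply: measurable_funX; exact: measurable_funB.
- move=> x _ /=; rewrite lee_fin (le_trans (HC x))// ler_norm//.
- under eq_fun do rewrite EFinM.
  by apply: integrableZl => //; exact: integrable_normal_pdf.
Qed.

Lemma normal_moment_fun_bounded m s k : s != 0 -> exists C : R,
  forall x, `|g m s k x| <= C.
Proof.
move=> s0; have [C HC] := normal_moment_fun_dominated m k s0.
have t0 : Num.sqrt 2 * s != 0 by rewrite mulf_neq0// gt_eqF// sqrtr_gt0.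
exists (`|C| * normal_peak (Num.sqrt 2 * s)) => x.
apply: le_trans (HC x) _; apply: le_trans (ler_norm _) _; rewrite normrM.
by rewrite ler_wpM2l// (ger0_norm (normal_pdf_ge0 _ _ _)) normal_pdf_ub.
Qed.

(** Multiplying by [u n - m] raises the order by one, and the function of order [k.+1] is
    bounded. *)
Lemma normal_moment_fun_cvg0 m s k (u : nat -> R) : s != 0 ->
  `|u n| @[n --> \oo] --> +oo -> g m s k (u n) @[n --> \oo] --> (0 : R).
Proof.
move=> s0 uy; have [C HC] := normal_moment_fun_bounded m k.+1 s0.
apply/cvgr0Pnorm_le => e e0.
near=> n.
have un : `|m| + (`|C| + 1) / e <= `|u n|.
  by near: n; exact: (cvgryPge _).1 uy _.
have ux : (`|C| + 1) / e <= `|u n - m|.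
  by apply: le_trans (lerB_dist _ _); rewrite lerBrDl.
have x0 : 0 < `|u n - m| by apply: lt_le_trans ux; rewrite divr_gt0// ltr_wpDl.
rewrite -(ler_pM2r x0) -normrM.
have -> : g m s k (u n) * (u n - m) = g m s k.+1 (u n) by rewrite /g exprS; ring.
apply: le_trans (HC _) _; apply: le_trans (ler_norm _) _.
rewrite mulrC -ler_pdivrMr// mulrC; apply: le_trans ux.
by rewrite mulrC ler_pM2r ?invr_gt0// lerDl.
Unshelve. all: by end_near. Qed.

(** The integrand is the derivative of the moment function of order [k]. For [k = 0] the truncated
    predecessor is harmless, its coefficient being 0. *)
Lemma normal_moment_rec m s k : s != 0 ->
  (\int[mu]_x (k%:R * g m s k.-1 x - g m s k.+1 x / s ^+ 2)%:E = 0)%E.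
Proof.
move=> s0; apply: (@integral_deriv_line R (g m s k)).
- by move=> x; exact: is_derive_normal_moment_fun.
- move=> x; apply: cvgB; first apply: cvgMr; last apply: cvgMl;
  exact: continuous_normal_moment_fun.
- rewrite (_ : _ \o _ = (fun x => (k%:R)%:E * (g m s k.-1 x)%:E -
      ((s ^+ 2)^-1)%:E * (g m s k.+1 x)%:E)%E); last first.
    by apply/funext => x /=; rewrite -!EFinM -EFinB [_^-1 * _]mulrC.
  by apply: integrableB => //; apply: integrableZl => //;
    exact: integrable_normal_moment_fun.
- apply: normal_moment_fun_cvg0 => //.
  by under eq_fun do rewrite normr_nat; exact: cvgr_idn.
- apply: normal_moment_fun_cvg0 => //.
  by under eq_fun do rewrite normrN normr_nat; exact: cvgr_idn.
Qed.

Definition normal_moment m s k : R := fine (\int[mu]_x (g m s k x)%:E)%E.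

Lemma integral_normal_moment_fun m s k : s != 0 ->
  (\int[mu]_x (g m s k x)%:E = (normal_moment m s k)%:E)%E.
Proof.
move=> s0; rewrite fineK//; apply: integrable_fin_num => //.
exact: integrable_normal_moment_fun.
Qed.

Lemma normal_momentSS m s k : s != 0 ->
  normal_moment m s k.+1 = s ^+ 2 * k%:R * normal_moment m s k.-1.
Proof.
move=> s0; have := normal_moment_rec m k s0.
rewrite (_ : (fun x => _) = (fun x => (k%:R)%:E * (g m s k.-1 x)%:E -
    ((s ^+ 2)^-1)%:E * (g m s k.+1 x)%:E)%E); last first.
  by apply/funext => x /=; rewrite -!EFinM -EFinB [_^-1 * _]mulrC.
have ig := integrable_normal_moment_fun m _ s0.
rewrite integralB//; [|by apply: integrableZl => //; exact: ig..].
have Z c j : (\int[mu]_x (c%:E * (g m s j x)%:E) = (c * normal_moment m s j)%:E)%E.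
  by rewrite (integralZl measurableT (ig j)) /= integral_normal_moment_fun// EFinM.
rewrite !Z -EFinB => -[] /eqP; rewrite subr_eq0 => /eqP h.
by rewrite -mulrA h mulVKf// expf_neq0.
Qed.

Lemma normal_moment0 m s : s != 0 -> normal_moment m s 0 = 1.
Proof.
move=> s0; rewrite /normal_moment /g.
by under eq_integral do rewrite expr0 mul1r; rewrite integral_normal_pdf.
Qed.

Lemma normal_moment1 m s : s != 0 -> normal_moment m s 1 = 0.
Proof. by move=> s0; rewrite normal_momentSS// mulr0 mul0r. Qed.

Lemma normal_moment2 m s : s != 0 -> normal_moment m s 2 = s ^+ 2.
Proof. by move=> s0; rewrite normal_momentSS// normal_moment0// !mulr1. Qed.

Lemma normal_moment4 m s : s != 0 -> normal_moment m s 4 = 3 * (s ^+ 2) ^+ 2.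
Proof. by move=> s0; rewrite normal_momentSS//= normal_moment2//; ring. Qed.

End normal_moments.

(** * Square integrable variables and averages *)

Section expectation.
Context d (T : measurableType d) (R : realType) (P : probability T R).
Implicit Types (X Y Z : T -> R) (c : R).

Definition intg X := P.-integrable setT (EFin \o X).
Definition expect X : R := \int[P]_w X w.
Definition sqint X := measurable_fun setT X /\ intg (fun w => X w ^+ 2).

Lemma le_intg X Y : measurable_fun setT X -> (forall w, `|X w| <= Y w) ->
  intg Y -> intg X.
Proof.
move=> mX XY iY; apply: le_integrable iY => //; first exact/measurable_EFinP.
by move=> w _ /=; rewrite lee_fin (le_trans (XY w))// ler_norm.
Qed.

Lemma intg_cst c : intg (fun=> c).
Proof. exact: finite_measure_integrable_cst. Qed.

Lemma intgD X Y : intg X -> intg Y -> intg (fun w => X w + Y w).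
Proof. by move=> iX iY; apply: integrableD iX iY. Qed.

Lemma intgB X Y : intg X -> intg Y -> intg (fun w => X w - Y w).
Proof. by move=> iX iY; apply: integrableB iX iY. Qed.

Lemma intgZ c X : intg X -> intg (fun w => c * X w).
Proof. by move=> iX; apply: integrableZl iX. Qed.

Lemma intg_sum n (U : nat -> T -> R) :
  (forall k, intg (U k)) -> intg (fun w => \sum_(k < n) U k w).
Proof.
move=> iU; elim: n => [|n IH].
  by under eq_fun do rewrite big_ord0; exact: intg_cst.
by under eq_fun do rewrite big_ord_recr; exact: intgD.
Qed.

Lemma meanE X : intg X -> (\int[P]_w (X w)%:E = (expect X)%:E)%E.
Proof. by move=> iX; rewrite /expect /Rintegral fineK// integrable_fin_num. Qed.

Lemma mean_cst c : expect (fun=> c) = c.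
Proof. rewrite /expect Rintegral_cst//.
by have := congr1 fine (probability_setT P) => /= ->; rewrite mulr1. Qed.

Lemma meanD X Y : intg X -> intg Y -> expect (fun w => X w + Y w) = expect X + expect Y.
Proof. by move=> iX iY; rewrite /expect RintegralD. Qed.

Lemma meanB X Y : intg X -> intg Y -> expect (fun w => X w - Y w) = expect X - expect Y.
Proof. by move=> iX iY; rewrite /expect RintegralB. Qed.

Lemma meanZ c X : intg X -> expect (fun w => c * X w) = c * expect X.
Proof. by move=> iX; rewrite /expect RintegralZl. Qed.

Lemma mean_sum n (U : nat -> T -> R) : (forall k, intg (U k)) ->
  expect (fun w => \sum_(k < n) U k w) = \sum_(k < n) expect (U k).
Proof.
move=> iU; elim: n => [|n IH].
  by rewrite big_ord0; under eq_fun do rewrite big_ord0; exact: mean_cst.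
rewrite big_ord_recr /= -IH -meanD//; last exact: intg_sum.
by under eq_fun do rewrite big_ord_recr.
Qed.

Lemma mean_ge0 X : (forall w, 0 <= X w) -> 0 <= expect X.
Proof. by move=> X0; apply: Rintegral_ge0. Qed.

Lemma le_mean X Y : intg X -> intg Y -> (forall w, X w <= Y w) -> expect X <= expect Y.
Proof. by move=> iX iY XY; apply: le_Rintegral. Qed.

Lemma intgM X Y : sqint X -> sqint Y -> intg (fun w => X w * Y w).
Proof.
move=> [mX iX] [mY iY]; apply: (le_intg _ _ (intgD iX iY)).
  exact: measurable_funM.
move=> w; rewrite normrM -real_normK ?num_real// -[X in _ + X]real_normK ?num_real//.
have := sqr_ge0 (`|X w| - `|Y w|); have := sqr_ge0 (`|X w|); have := sqr_ge0 (`|Y w|).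
nra.
Qed.

Lemma sqint_cst c : sqint (fun=> c).
Proof. by split; [exact: measurable_cst|exact: intg_cst]. Qed.

Lemma sqint_intg X : sqint X -> intg X.
Proof.
move=> sX; have := intgM sX (sqint_cst 1).
by under eq_fun do rewrite mulr1.
Qed.

Lemma sqintZ c X : sqint X -> sqint (fun w => c * X w).
Proof.
move=> [mX iX]; split; first exact: measurable_funM.
by under eq_fun do rewrite exprMn; exact: intgZ.
Qed.

Lemma sqintD X Y : sqint X -> sqint Y -> sqint (fun w => X w + Y w).
Proof.
move=> sX sY; split; first by apply: measurable_funD; [case: sX|case: sY].
under eq_fun do rewrite sqrrD -mulr_natl.
by apply: intgD; [apply: intgD; [case: sX|exact/intgZ/intgM]|case: sY].
Qed.

Lemma sqintB X Y : sqint X -> sqint Y -> sqint (fun w => X w - Y w).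
Proof.
move=> sX sY; have := sqintD sX (sqintZ (-1) sY).
by under eq_fun do rewrite mulN1r.
Qed.

Lemma sqint_sum n (U : nat -> T -> R) :
  (forall k, sqint (U k)) -> sqint (fun w => \sum_(k < n) U k w).
Proof.
move=> sU; elim: n => [|n IH].
  by under eq_fun do rewrite big_ord0; exact: sqint_cst.
by under eq_fun do rewrite big_ord_recr; exact: sqintD.
Qed.

(** Induction on the number of terms: the new index [n] adds its square, at most [r 0], and twice
    its products with the earlier ones, whose lags run once through 1 to [n]. *)
Lemma mean_average_sqr_le (U : nat -> T -> R) (r : nat -> R) n :
  (forall k, sqint (U k)) ->
  (forall k i, `|expect (fun w => U k w * U (k + i)%N w)| <= r i) ->
  expect (fun w => average n (U ^~ w) ^+ 2) <= 2 * (n%:R^-1 * \sum_(i < n) r i).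
Proof.
move=> sU rU.
have r_ge0 i : 0 <= r i by apply: le_trans (rU 0%N i).
have S_le : expect (fun w => (\sum_(k < n) U k w) ^+ 2) <=
    (n%:R * 2) * \sum_(i < n) r i.
  elim: n => [|{}n IH].
    by under eq_fun do rewrite big_ord0 expr0n; rewrite mean_cst big_ord0 mulr0.
  have sS := sqint_sum n sU.
  have E : expect (fun w => (\sum_(k < n.+1) U k w) ^+ 2) =
      expect (fun w => (\sum_(k < n) U k w) ^+ 2) +
      2 * \sum_(k < n) expect (fun w => U k w * U n w) + expect (fun w => U n w * U n w).
    rewrite -(@mean_sum n (fun k w => U k w * U n w)); last by move=> k; exact: intgM.
    rewrite -meanZ; last by apply: (@intg_sum n (fun k w => U k w * U n w)) => k; exact: intgM.
    rewrite -meanD; [|by case: sS|]; last first.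
      by apply/intgZ/(@intg_sum n (fun k w => U k w * U n w)) => k; exact: intgM.
    rewrite -meanD; [| |exact: intgM].
      by congr expect; apply/funext => w; rewrite big_ord_recr /= -mulr_suml; ring.
    apply: intgD; first by case: sS.
    by apply/intgZ/(@intg_sum n (fun k w => U k w * U n w)) => k; exact: intgM.
  have H1 : \sum_(k < n) expect (fun w => U k w * U n w) <= \sum_(i < n) r i.+1.
    rewrite (reindex_inj rev_ord_inj) /=; apply: ler_sum => i _.
    have -> : U n = U (n - i.+1 + i.+1)%N by rewrite subnK.
    by apply: le_trans (ler_norm _) _; exact: rU.
  have H2 : expect (fun w => U n w * U n w) <= r 0%N.
    by have := rU n 0%N; rewrite addn0; apply: le_trans; exact: ler_norm.
  have H3 : \sum_(i < n) r i.+1 + r 0%N = \sum_(i < n.+1) r i by rewrite big_ord_recl addrC.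
  have H4 : \sum_(i < n) r i <= \sum_(i < n.+1) r i by rewrite big_ord_recr lerDl.
  have H5 : 0 <= \sum_(i < n) r i.+1 by apply: sumr_ge0.
  rewrite E mulrSr; have H6 : 0 <= n%:R * 2 :> R by rewrite mulr_ge0.
  have := ler_wpM2l H6 H4; have := r_ge0 0%N.
  lra.
have -> : expect (fun w => average n (U ^~ w) ^+ 2) =
    n%:R^-1 ^+ 2 * expect (fun w => (\sum_(k < n) U k w) ^+ 2).
  rewrite -meanZ; last by case: (sqint_sum n sU).
  by congr expect; apply/funext => w; rewrite /average exprMn.
apply: le_trans (ler_wpM2l _ S_le) _; first exact: sqr_ge0.
have [->|n0] := eqVneq n 0%N; first by rewrite !big_ord0 !mulr0.
have n0' : n%:R != 0 :> R by rewrite pnatr_eq0.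
by rewrite le_eqVlt; apply/orP; left; apply/eqP; field.
Qed.

Lemma mean_average_sqr_cvg0 (U : nat -> T -> R) (r : nat -> R) :
  (forall k, sqint (U k)) ->
  (forall k i, `|expect (fun w => U k w * U (k + i)%N w)| <= r i) ->
  r i @[i --> \oo] --> (0 : R) ->
  expect (fun w => average n (U ^~ w) ^+ 2) @[n --> \oo] --> (0 : R).
Proof.
move=> sU rU r0.
have B n : 0 <= expect (fun w => average n (U ^~ w) ^+ 2) <= 2 * (n%:R^-1 * \sum_(i < n) r i).
  by rewrite mean_average_sqr_le// andbT; apply: mean_ge0 => w; exact: sqr_ge0.
rewrite -cvg_shiftS /=.
have := cesaro r0; rewrite /arithmetic_mean => C.
apply: (@squeeze_cvgr _ _ _ _ (fun=> 0) (fun n => 2 * (n.+1%:R^-1 * series r n.+1))).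
- by apply: nearW => n; have := B n.+1; rewrite /series /= big_mkord.
- exact: cvg_cst.
- by rewrite -[X in _ --> X](mulr0 2); apply: cvgM; [exact: cvg_cst|exact: C].
Qed.

(** The joint law agrees with the product law on rectangles, hence everywhere, and Fubini factors
    the integral of the product of the coordinates. *)
Lemma mean_indep X Y : sqint X -> sqint Y ->
  (forall A B : set R, measurable A -> measurable B ->
    P (X @^-1` A `&` Y @^-1` B) = (P (X @^-1` A) * P (Y @^-1` B))%E) ->
  expect (fun w => X w * Y w) = expect X * expect Y.
Proof.
move=> sX sY XY; have [mX _] := sX; have [mY _] := sY.
pose X' : {RV P >-> R} := HB.pack X (isMeasurableFun.Build _ _ _ _ _ mX).
pose Y' : {RV P >-> R} := HB.pack Y (isMeasurableFun.Build _ _ _ _ _ mY).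
pose Z w := (X w, Y w).
have mZ : measurable_fun setT Z by exact: measurable_fun_pair.
pose Z' : {RV P >-> (R * R)%type} := HB.pack Z (isMeasurableFun.Build _ _ _ _ _ mZ).
pose m1 : probability R R := distribution P X'.
pose m2 : probability R R := distribution P Y'.
pose m3 : probability (R * R)%type R := distribution P Z'.
have m123 A : measurable A -> (m1 \x m2)%E A = m3 A.
  by apply: product_measure_unique => A1 B1 mA mB; exact: XY.
pose f (z : R * R) := (z.1 * z.2)%:E.
have mf : measurable_fun setT f.
  by apply/measurable_EFinP; apply: measurable_funM; [exact: measurable_fst|exact: measurable_snd].
have if3 : m3.-integrable setT f.
  apply: (@integrable_pushforward _ _ _ _ _ Z mZ P setT f mf) => //.
  exact: intgM.
have if12 : (m1 \x m2)%E.-integrable setT f.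
  apply/integrableP; split => //; have /integrableP[_ h] := if3.
  by rewrite (eq_measure_integral m3)// => A mA _; exact: m123.
have E1 : (\int[m1 \x m2]_z f z = (expect (fun w => X w * Y w))%:E)%E.
  rewrite (eq_measure_integral m3); last by move=> A mA _; exact: m123.
  rewrite -meanE; last exact: intgM.
  rewrite (@integral_pushforward _ _ _ _ _ Z mZ P setT f mf)//.
  exact: intgM.
have E2 : (\int[m1 \x m2]_z f z = (expect X * expect Y)%:E)%E.
  rewrite -integral12_prod_meas1//= /fubini_F /f /=.
  have i2 : (\int[m2]_y y%:E = (expect Y)%:E)%E.
    rewrite (@integral_pushforward _ _ _ _ _ Y mY P setT EFin)//.
      by rewrite -meanE//; exact: sqint_intg.
    exact: sqint_intg.
  have i1 : (\int[m1]_x x%:E = (expect X)%:E)%E.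
    rewrite (@integral_pushforward _ _ _ _ _ X mX P setT EFin)//.
      by rewrite -meanE//; exact: sqint_intg.
    exact: sqint_intg.
  have im (X0 : T -> R) (mX0 : measurable_fun setT X0) (sX0 : sqint X0) :
      (pushforward P X0).-integrable setT EFin.
    by apply: integrable_pushforward => //; exact: sqint_intg.
  under eq_integral => x _.
    under eq_integral do rewrite EFinM.
    rewrite integralZl//; last exact: im.
    rewrite i2.
    over.
  by rewrite integralZr//; [rewrite i1 -EFinM|exact: im].
by apply: EFin_inj; rewrite -E1.
Qed.

(** The series of the [W k] has finite mean, so it converges almost surely and its terms vanish.
    This replaces a Borel-Cantelli argument, both in the choice of the number of observations and in
    the law of large numbers. *)
Lemma ae_cvg0_of_mean (W : nat -> T -> R) C :
  (forall k, intg (W k)) -> (forall k w, 0 <= W k w) ->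
  (forall n, \sum_(k < n) expect (W k) <= C) ->
  {ae P, forall w, W k w @[k --> \oo] --> (0 : R)}.
Proof.
move=> iW W0 WC.
have mW k : measurable_fun setT (EFin \o W k) by case/integrableP: (iW k).
pose S w := (\sum_(0 <= k <oo) (W k w)%:E)%E.
have mS : measurable_fun setT S.
  rewrite /S; have := @ge0_emeasurable_sum _ T R setT (fun k w => (W k w)%:E) predT.
  by apply => [k w _ _|k _]; [rewrite lee_fin|exact: mW].
have iS : P.-integrable setT S.
  apply/integrableP; split => //.
  have S0 w : (0 <= S w)%E by apply: nneseries_ge0 => k _ _; rewrite lee_fin.
  rewrite (eq_integral S); last by move=> w _; rewrite gee0_abs.
  rewrite /S.
  rewrite integral_nneseries//; last by move=> k w _; rewrite lee_fin.
  apply: (@le_lt_trans _ _ C%:E); last exact: ltry.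
  apply: lime_le.
    by apply: is_cvg_nneseries => k _ _; apply: integral_ge0 => w _; rewrite lee_fin.
  apply: nearW => n; rewrite big_mkord.
  rewrite (eq_bigr (fun k => (expect (W (nat_of_ord k)))%:E)); last by move=> k _; exact: meanE.
  by rewrite sumEFin lee_fin; exact: WC.
have := integrable_ae measurableT iS.
apply: filterS => w /(_ I) Sfin.
apply: cvg_series_cvg_0; apply: nondecreasing_is_cvgn.
  by apply/nondecreasing_seqP => n; rewrite /series /= big_nat_recr//= lerDl.
exists (fine (S w)) => _ [n _ <-].
rewrite -lee_fin fineK// /series /= -sumEFin.
by apply: nneseries_lim_ge => k _; rewrite lee_fin.
Qed.

End expectation.

(** * Normal random variables *)

(** The change of variables is expressed with the Radon-Nikodym derivative, which equals
    [normal_pdf] almost everywhere because both have the same integral over every measurable set. *)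
Lemma ge0_integral_normal_prob (R : realType) (m s : R) (f : R -> \bar R) :
  measurable_fun setT f -> (forall x, 0 <= f x)%E ->
  (\int[normal_prob m s]_x f x =
   \int[@lebesgue_measure R]_x (f x * (normal_pdf m s x)%:E))%E.
Proof.
move=> mf f0; set mu := @lebesgue_measure R.
have dom := @normal_prob_dominates R m s.
rewrite -(@Radon_Nikodym_SigmaFinite.change_of_variables _ _ _ _ _ dom)//.
have iRN := Radon_Nikodym_SigmaFinite.f_integrable dom.
have mRN := measurable_int mu iRN.
have mpdf : measurable_fun setT (fun x => (normal_pdf m s x)%:E).
  by apply/measurable_EFinP; exact: measurable_normal_pdf.
apply: ae_eq_integral => //.
- exact: emeasurable_funM.
- exact: emeasurable_funM.
- apply: ae_eqe_mul2l; apply: integral_ae_eq => //.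
  move=> E _ mE.
  by rewrite -Radon_Nikodym_SigmaFinite.f_integral.
Qed.

Section normal.
Context d (T : measurableType d) (R : realType) (P : probability T R).

Lemma is_normal_ge0_integral (X : T -> R) (m v : R) (f : R -> R) :
  measurable_fun setT X -> is_normal P X m v ->
  measurable_fun setT f -> (forall x, 0 <= f x) ->
  (\int[P]_w (f (X w))%:E = if v == 0%R then (f m)%:E else
    \int[@lebesgue_measure R]_x (f x * normal_pdf m (Num.sqrt v) x)%:E)%E.
Proof.
move=> mX [v0 PX] mf f0.
(* The law is pushed forward to [measurableTypeR R], the measurable type carrying
   [normal_prob], which is not unifiable with the one carried by [R] itself. *)
have mX' : @measurable_fun _ _ T (measurableTypeR R) setT X by exact: mX.
have mEf : measurable_fun (setT : set (measurableTypeR R)) (EFin \o f).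
  exact/measurable_EFinP.
pose X' : {RV P >-> measurableTypeR R} :=
  HB.pack X (isMeasurableFun.Build _ _ _ _ _ mX').
transitivity (\int[distribution P X']_x (EFin \o f) x)%E.
  by rewrite ge0_integral_distribution// => x; rewrite lee_fin.
case: eqVneq PX => [_ PX|vn0 PX].
  transitivity (\int[dirac (m : measurableTypeR R)]_x (EFin \o f) x)%E.
    by apply: eq_measure_integral => A mA _; exact: PX.
  by rewrite integral_dirac// diracT mul1e.
transitivity (\int[normal_prob m (Num.sqrt v)]_x (EFin \o f) x)%E.
  by apply: eq_measure_integral => A mA _; exact: PX.
by rewrite ge0_integral_normal_prob// => x; rewrite lee_fin.
Qed.

Lemma is_normal_moments (X : T -> R) (m v : R) :
  measurable_fun setT X -> is_normal P X m v ->
  [/\ intg P (fun w => (X w - m) ^+ 4), intg P (fun w => (X w - m) ^+ 2),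
      expect P (fun w => X w - m) = 0, expect P (fun w => (X w - m) ^+ 2) = v &
      expect P (fun w => (X w - m) ^+ 4) = 3 * v ^+ 2].
Proof.
move=> mX NX; have v0 : 0 <= v by case: NX.
have mXm : measurable_fun setT (fun w => X w - m) by exact: measurable_funB.
have E (f : R -> R) c : measurable_fun setT f -> (forall x, 0 <= f x) ->
    (if v == 0%R then (f m)%:E else
    \int[@lebesgue_measure R]_x (f x * normal_pdf m (Num.sqrt v) x)%:E)%E = c%:E ->
    intg P (f \o X) /\ expect P (f \o X) = c.
  move=> mf f0 fc; have H := is_normal_ge0_integral mX NX mf f0.
  rewrite fc in H.
  have iF : intg P (f \o X).
    apply/integrableP; split; first exact/measurable_EFinP/measurableT_comp.
    rewrite (eq_integral (fun w => (f (X w))%:E)); last first.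
      by move=> w _ /=; rewrite ger0_norm.
    by rewrite H ltry.
  by split => //; apply: EFin_inj; rewrite -meanE.
have sv0 : v != 0 -> Num.sqrt v != 0.
  by move=> vn0; rewrite gt_eqF// sqrtr_gt0 lt_neqAle eq_sym vn0.
have [i4 m4] : intg P ((fun x => (x - m) ^+ 4) \o X) /\
    expect P ((fun x => (x - m) ^+ 4) \o X) = 3 * v ^+ 2.
  apply: E.
  - by apply: measurable_funX; exact: measurable_funB.
  - by move=> x; rewrite exprn_even_ge0.
  - case: eqVneq => [->|vn0]; first by rewrite subrr !expr0n /= mulr0.
    have := integral_normal_moment_fun m 4 (sv0 vn0).
    by rewrite normal_moment4 ?sv0// sqr_sqrtr.
have [i2 m2] : intg P ((fun x => (x - m) ^+ 2) \o X) /\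
    expect P ((fun x => (x - m) ^+ 2) \o X) = v.
  apply: E.
  - by apply: measurable_funX; exact: measurable_funB.
  - by move=> x; rewrite exprn_even_ge0.
  - case: eqVneq => [->|vn0]; first by rewrite subrr !expr0n.
    have := integral_normal_moment_fun m 2 (sv0 vn0).
    by rewrite normal_moment2 ?sv0// sqr_sqrtr.
(* The transfer formula concerns nonnegative functions, so the first moment is read off from the
   means of the squares of [X - m + 1] and [X - m]. *)
have [i1 m1] : intg P ((fun x => (x - m + 1) ^+ 2) \o X) /\
    expect P ((fun x => (x - m + 1) ^+ 2) \o X) = v + 1.
  apply: E.
  - by apply: measurable_funX; apply: measurable_funD => //; exact: measurable_funB.
  - by move=> x; rewrite exprn_even_ge0.
  - case: eqVneq => [->|vn0]; first by rewrite subrr !add0r expr1n.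
    have i k := integrable_normal_moment_fun m k (sv0 vn0).
    pose g := normal_moment_fun m (Num.sqrt v).
    rewrite (_ : (fun x => _) = (fun x => (g 2 x)%:E + (2%:E * (g 1 x)%:E + (g 0 x)%:E))%E); last first.
      by apply/funext => x; rewrite -!EFinM -!EFinD /g /normal_moment_fun; congr EFin; ring.
    rewrite integralD//; last 2 first.
      exact: i.
      by apply: integrableD => //; [apply: integrableZl => //; exact: i|exact: i].
    rewrite integralD//; last 2 first.
      by apply: integrableZl => //; exact: i.
      exact: i.
    rewrite integralZl//; last exact: i.
    rewrite !integral_normal_moment_fun ?sv0// normal_moment0 ?sv0// normal_moment1 ?sv0//.
    by rewrite normal_moment2 ?sv0// sqr_sqrtr// mule0 add0e.
split=> //.
have sXm : sqint P (fun w => X w - m) by split.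
have i0 := sqint_intg sXm.
have : expect P ((fun x => (x - m + 1) ^+ 2) \o X) = v + 2 * expect P (fun w => X w - m) + 1.
  rewrite -m2 -meanZ// -meanD//; last exact: intgZ.
  rewrite -[X in _ + X](mean_cst P) -meanD; last 2 first.
    by apply: intgD => //; exact: intgZ.
    exact: intg_cst.
  by congr expect; apply/funext => w /=; ring.
rewrite m1; lra.
Qed.

End normal.

(** * Decay of correlations of the noise increments *)

Section powR_increments.
Variable R : realType.
Implicit Types (x a : R).

(** Convexity of the exponential between [ln x] and 0, with weights [a] and [1 - a]. *)
Lemma powR_le_bernoulli x a : 0 <= x -> 0 <= a <= 1 -> x `^ a <= 1 + a * (x - 1).
Proof.
move=> x0 /andP[a0 a1]; have [<-|xn0] := eqVneq 0 x.
  have [->|an0] := eqVneq a 0; first by rewrite powRr0 mul0r addr0.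
  by rewrite powR0// sub0r mulrN1 subr_ge0.
have xgt0 : 0 < x by rewrite lt_neqAle xn0.
have ia : Itv.spec (@Itv.num_sem R) (Itv.Real `[0%Z, 1%Z]) a.
  by rewrite /= /Itv.num_sem /= in_itv /= a0 a1 ger0_real.
have := @convex_expR R (Itv.mk ia) (ln x) 0.
rewrite !convRE /= expR0 mulr0 addr0 mulr1 lnK ?posrE// -[expR _]/(expR (a * ln x)).
rewrite /powR (gt_eqF xgt0) => h; apply: le_trans h _.
by rewrite /unstable.onem; lra.
Qed.

Lemma powR_ge_bernoulli x a : 0 <= x -> 1 <= a -> 1 + a * (x - 1) <= x `^ a.
Proof.
move=> x0 a1; have a0 : 0 < a by exact: lt_le_trans a1.
have ai : 0 <= a^-1 <= 1 by rewrite invr_ge0 (ltW a0) invf_le1.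
have := powR_le_bernoulli (powR_ge0 x a) ai.
rewrite -powRrM divff ?gt_eqF// powRr1// => h.
have := ler_wpM2l (ltW a0) h; rewrite mulrDr mulrA divff ?gt_eqF//; lra.
Qed.

(** From below, the tangent bounds at 1 add up to 2. From above, $y^a=y\,y^{a-1}$ with
    $a-1\in[0,1]$, where the concave bound applies; the linear terms cancel and leave
    $2(a-1)x^2$. *)
Lemma powR_second_difference x a : 0 <= x <= 1 -> 1 <= a <= 2 ->
  `|(1 + x) `^ a + (1 - x) `^ a - 2| <= 2 * x ^+ 2.
Proof.
move=> /andP[x0 x1] /andP[a1 a2].
have h (y : R) : 0 <= y -> 1 + a * (y - 1) <= y `^ a <= y * (1 + (a - 1) * (y - 1)).
  move=> y0; rewrite powR_ge_bernoulli//= -(mulr_powRB1 y0); last exact: lt_le_trans a1.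
  rewrite ler_wpM2l// powR_le_bernoulli//; apply/andP; split; lra.
have /andP[p1 p2] := h (1 + x) (addr_ge0 ler01 x0).
have y0 : 0 <= 1 - x by rewrite subr_ge0.
have /andP[q1 q2] := h (1 - x) y0.
rewrite ler_norml; apply/andP; split; first by have := sqr_ge0 x; lra.
have : 0 <= (2 - a) * x ^+ 2 by rewrite mulr_ge0 ?sqr_ge0// subr_ge0.
nra.
Qed.

(* Covariance of two increments of length [j] at distance [i] of a fractional
   Brownian motion with Hurst index [a / 2]. *)
Definition fgn_cov (a h : R) (j i : nat) : R :=
  (`|i%:R * h - j%:R * h| `^ a + ((i + j)%:R * h) `^ a - 2 * (i%:R * h) `^ a) / 2.

(** Factoring out $(ih)^a$ leaves a second difference of $y\mapsto y^a$ at 1 with step $x=j/i$, of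
    order $x^2$. The covariance is thus $O(i^{a-2})$, and with $a=2H$ the decay expresses $H<1$. *)
Lemma fgn_cov_cvg0 a h j : 0 < h -> 1 <= a < 2 ->
  fgn_cov a h j i @[i --> \oo] --> (0 : R).
Proof.
move=> h0 /andP[a1 a2].
have a0 : 0 < a by exact: lt_le_trans a1.
pose u i : R := h `^ a * (j%:R ^+ 2 * (i%:R^-1) `^ (2 - a)).
have bound i : (j <= i)%N -> (0 < i)%N -> `|fgn_cov a h j i| <= u i.
  move=> ji i0; have i0' : 0 < i%:R :> R by rewrite ltr0n.
  pose x : R := j%:R / i%:R.
  have x0 : 0 <= x by rewrite divr_ge0.
  have x1 : x <= 1 by rewrite ler_pdivrMr// mul1r ler_nat.
  have xx : 0 <= x <= 1 by rewrite x0 x1.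
  have aa : 1 <= a <= 2 by rewrite a1 ltW.
  have := powR_second_difference xx aa.
  have -> : fgn_cov a h j i =
      h `^ a * i%:R `^ a * (((1 + x) `^ a + (1 - x) `^ a - 2) / 2).
    rewrite /fgn_cov -mulrBl normrM (gtr0_norm h0) (@ger0_norm _ (i%:R - _)) ?subr_ge0 ?ler_nat//.
    have -> : i%:R - j%:R = i%:R * (1 - x) :> R by rewrite /x; field; rewrite gt_eqF.
    have -> : (i + j)%:R = i%:R * (1 + x) :> R by rewrite natrD /x; field; rewrite gt_eqF.
    rewrite !powRM ?(ltW h0) ?(ltW i0') ?mulr_ge0 ?subr_ge0 ?addr_ge0 ?(ltW i0')//.
    by field.
  rewrite normrM (ger0_norm (mulr_ge0 _ _)) ?powR_ge0// => hx.
  rewrite normrM (@ger0_norm _ 2^-1)//.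
  apply: (@le_trans _ _ (h `^ a * i%:R `^ a * (2 * x ^+ 2 / 2))).
    by rewrite ler_wpM2l ?mulr_ge0 ?powR_ge0// ler_wpM2r.
  rewrite /u -mulrA ler_wpM2l ?powR_ge0//.
  have -> : i%:R `^ a = i%:R ^+ 2 * (i%:R^-1) `^ (2 - a).
    rewrite -powR_mulrn ?(ltW i0')// -(powR_inv1 (ltW i0')) -powRrM -powRD; last first.
      by rewrite (gt_eqF i0') implybT.
    by congr (_ `^ _); ring.
  rewrite /x expr_div_n le_eqVlt; apply/orP; left; apply/eqP.
  by field; rewrite gt_eqF.
have u0 : u i @[i --> \oo] --> (0 : R).
  rewrite -(mulr0 (h `^ a)); apply: cvgMr; rewrite -(mulr0 (j%:R ^+ 2)); apply: cvgMr.
  have p0 : 0 < 2 - a by rewrite subr_gt0.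
  have c0 : (i%:R^-1 : R) @[i --> \oo] --> (0 : R).
    apply/gtr0_cvgV0; last exact: cvgr_idn.
    by near=> i; rewrite ltr0n; near: i; exact: nbhs_infty_gt.
  have := powR_cvg0 p0; apply: cvg_comp => A /= HA.
  have HA' : \forall i \near \oo, 0 < (i%:R^-1 : R) -> A (i%:R^-1 : R) := c0 _ HA.
  near=> i; apply: (near HA' i) => //.
  by rewrite /= invr_gt0 ltr0n; near: i; exact: nbhs_infty_gt.
apply/norm_cvg0P.
apply: (@squeeze_cvgr _ _ _ _ (fun=> 0) u) => //; last exact: cvg_cst.
near=> i; rewrite normr_ge0 /=; apply: bound; near: i.
  exact: nbhs_infty_ge.
exact: nbhs_infty_gt.
Unshelve. all: by end_near. Qed.

Lemma fgn_cov0 a h j : a != 0 -> 0 <= h -> fgn_cov a h j 0 = (j%:R * h) `^ a.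
Proof.
move=> a0 h0; rewrite /fgn_cov mul0r sub0r normrN add0n powR0// mulr0 subr0.
by rewrite ger0_norm ?mulr_ge0//; field.
Qed.

End powR_increments.

(** * Averages of weakly correlated sequences *)

Section increments.
Context d (T : measurableType d) (R : realType) (P : probability T R).
Local Notation mean := (expect P).
Local Notation intg := (intg P).
Local Notation sqint := (sqint P).

(** The interface shared by the two noises. The rates depend on the lag only, as the Cesaro argument
    requires, and bear on the variables as well as on their squares centred at [v]. *)
Record mixing_increments (c : nat -> T -> R) (v : R) : Prop := {
  mixing_measurable : forall k, measurable_fun setT (c k) ;
  mixing_moment4 : forall k, intg (fun w => c k w ^+ 4) ;
  mixing_rate : exists2 r : nat -> R, r i @[i --> \oo] --> (0 : R) &
    forall k i, `|mean (fun w => c k w * c (k + i)%N w)| <= r i ;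
  mixing_sqr_rate : exists2 r : nat -> R, r i @[i --> \oo] --> (0 : R) &
    forall k i, `|mean (fun w => (c k w ^+ 2 - v) * (c (k + i)%N w ^+ 2 - v))| <= r i
}.

Lemma moment4_sqr_sqint (X : T -> R) : measurable_fun setT X ->
  intg (fun w => X w ^+ 4) -> sqint (fun w => X w ^+ 2).
Proof.
move=> mX iX; split; first exact: measurable_funX.
by under eq_fun do rewrite -exprM.
Qed.

Lemma moment4_sqint (X : T -> R) : measurable_fun setT X ->
  intg (fun w => X w ^+ 4) -> sqint X.
Proof.
move=> mX iX; split => //; exact/sqint_intg/moment4_sqr_sqint.
Qed.

Lemma mean_indep_comp (X Y : T -> R) (f g : R -> R) :
  sqint (fun w => f (X w)) -> sqint (fun w => g (Y w)) ->
  measurable_fun setT f -> measurable_fun setT g ->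
  (forall A B : set R, measurable A -> measurable B ->
    P (X @^-1` A `&` Y @^-1` B) = (P (X @^-1` A) * P (Y @^-1` B))%E) ->
  mean (fun w => f (X w) * g (Y w)) =
  mean (fun w => f (X w)) * mean (fun w => g (Y w)).
Proof.
move=> sX sY mf mg XY; apply: mean_indep => // A B mA mB.
apply: (XY (f @^-1` A) (g @^-1` B)); rewrite -[X in measurable X]setTI.
  exact: mf.
exact: mg.
Qed.

Lemma intg_lin3 a b c (X Y Z : T -> R) : intg X -> intg Y -> intg Z ->
  intg (fun w => a * X w + b * Y w + c * Z w).
Proof. by move=> iX iY iZ; apply: intgD; [apply: intgD|]; exact: intgZ. Qed.

Lemma mean_lin3 a b c (X Y Z : T -> R) : intg X -> intg Y -> intg Z ->
  mean (fun w => a * X w + b * Y w + c * Z w) =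
  a * mean X + b * mean Y + c * mean Z.
Proof.
move=> iX iY iZ; rewrite meanD; [|by apply: intgD; exact: intgZ|exact: intgZ].
by rewrite meanD; [rewrite !meanZ|exact: intgZ|exact: intgZ].
Qed.

Lemma mean_sqrD (X Y : T -> R) c : sqint X -> sqint Y ->
  mean (fun w => (X w + c * Y w) ^+ 2) =
  mean (fun w => X w ^+ 2) + 2 * c * mean (fun w => X w * Y w) +
  c ^+ 2 * mean (fun w => Y w ^+ 2).
Proof.
move=> sX sY; have iXY := intgM sX sY.
have [_ iX] := sX; have [_ iY] := sY.
rewrite -[mean (fun w => X w ^+ 2)]mul1r -mean_lin3//.
by congr expect; apply/funext => w; ring.
Qed.

Lemma normr_meanM_le (X Y : T -> R) v : sqint X -> sqint Y ->
  mean (fun w => X w ^+ 2) = v -> mean (fun w => Y w ^+ 2) = v ->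
  `|mean (fun w => X w * Y w)| <= v.
Proof.
move=> sX sY Xv Yv.
have p c : 0 <= mean (fun w => (X w + c * Y w) ^+ 2) by apply: mean_ge0 => w; exact: sqr_ge0.
have := p 1; have := p (-1); rewrite !mean_sqrD// Xv Yv => h1 h2.
by rewrite ler_norml; apply/andP; split; lra.
Qed.

Lemma mixing_average_cvg0 c v : mixing_increments c v ->
  mean (fun w => average n (c ^~ w) ^+ 2) @[n --> \oo] --> (0 : R).
Proof.
case=> mc ic [r r0 hr] _; apply: (mean_average_sqr_cvg0 _ hr r0) => k.
exact: moment4_sqint.
Qed.

Lemma mixing_average_sqr_cvg0 c v : mixing_increments c v ->
  mean (fun w => average n (fun k => c k w ^+ 2 - v) ^+ 2) @[n --> \oo] --> (0 : R).
Proof.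
case=> mc ic _ [r r0 hr].
apply: (@mean_average_sqr_cvg0 _ _ _ P (fun k w => c k w ^+ 2 - v) r) => // k.
by apply: sqintB; [exact: moment4_sqr_sqint|exact: sqint_cst].
Qed.

Lemma sqintM (X Y : T -> R) :
  measurable_fun setT X -> intg (fun w => X w ^+ 4) ->
  measurable_fun setT Y -> intg (fun w => Y w ^+ 4) ->
  sqint (fun w => X w * Y w).
Proof.
move=> mX iX mY iY; split; first exact: measurable_funM.
under eq_fun do rewrite exprMn.
by apply: intgM; exact: moment4_sqr_sqint.
Qed.

Lemma mixing_average_mul_cvg0 c1 v1 c2 v2 :
  mixing_increments c1 v1 -> mixing_increments c2 v2 ->
  (forall k l, mean (fun w => (c1 k w * c1 l w) * (c2 k w * c2 l w)) =
     mean (fun w => c1 k w * c1 l w) * mean (fun w => c2 k w * c2 l w)) ->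
  mean (fun w => average n (fun k => c1 k w * c2 k w) ^+ 2) @[n --> \oo] --> (0 : R).
Proof.
case=> mc ic [r r0 hr] _ [mc2 ic2 [r2 r20 hr2] _] E.
apply: (@mean_average_sqr_cvg0 _ _ _ P (fun k w => c1 k w * c2 k w) (fun i => r i * r2 i)).
- by move=> k; exact: sqintM.
- move=> k i; have -> : mean (fun w => c1 k w * c2 k w * (c1 (k + i)%N w * c2 (k + i)%N w)) =
      mean (fun w => (c1 k w * c1 (k + i)%N w) * (c2 k w * c2 (k + i)%N w)).
    by congr expect; apply/funext => w; ring.
  by rewrite E normrM ler_pM.
- by rewrite -(mulr0 (0 : R)); exact: cvgM.
Qed.

End increments.

Section Brownian.
Context d (T : measurableType d) (R : realType) (P : probability T R).
Local Notation mean := (expect P).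
Local Notation intg := (intg P).
Local Notation sqint := (sqint P).
Variables (h : R) (h0 : 0 < h).

(* Lags [j] up to 4 and shifts [p] up to 2 suffice to express the statistics:
   products of adjacent increments are obtained by polarization. *)
Definition path_increment (y : R -> R) (j p k : nat) : R :=
  y ((k + p + j)%N%:R * h) - y ((k + p)%N%:R * h).

Lemma mutually_independent2 (I : choiceType) (G : I -> set (set T)) (i j : I)
    (A1 A2 : set T) :
  mutually_independent P G -> i != j -> G i A1 -> G j A2 ->
  P (A1 `&` A2) = (P A1 * P A2)%E.
Proof.
move=> mi ij GA1 GA2.
have := mi [fset i; j]%fset (fun k => if k == i then A1 else A2).
have -> : \bigcap_(k in [set` [fset i; j]%fset]) (if k == i then A1 else A2) = A1 `&` A2.
  rewrite eqEsubset; split => [w H|w [w1 w2] k /=].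
    split; [have := H i|have := H j].
      by rewrite /= !inE eqxx; exact.
    by rewrite /= !inE eqxx orbT eq_sym (negPf ij); exact.
  by rewrite !inE; case/orP => /eqP->; rewrite ?eqxx// eq_sym (negPf ij).
rewrite big_fsetU1/= ?big_seq_fset1 ?inE// eqxx eq_sym (negPf ij); apply.
by move=> k; rewrite !inE; case/orP => /eqP->; rewrite ?eqxx// eq_sym (negPf ij).
Qed.

Lemma brownian_increments_indep (W : R -> T -> R) j p k l (A B : set R) :
  is_brownian_motion P W -> (k + j <= l)%N -> measurable A -> measurable B ->
  P ((fun w => path_increment (W ^~ w) j p k) @^-1` A `&`
     (fun w => path_increment (W ^~ w) j p l) @^-1` B) =
  (P ((fun w => path_increment (W ^~ w) j p k) @^-1` A) *
   P ((fun w => path_increment (W ^~ w) j p l) @^-1` B))%E.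
Proof.
move=> bW kl mA mB.
(* Independence of increments is stated for infinite nondecreasing sequences of times: the four end
   points are listed and the last one is repeated, so that the increments wanted have index 0 and
   2. *)
pose s q : nat := match q with
  | 0 => (k + p)%N | 1 => (k + p + j)%N | 2 => (l + p)%N | _ => (l + p + j)%N end.
have snd q : (s q <= s q.+1)%N by case: q => [|[|[|q]]] //=; lia.
have := @bm_indep_increments _ _ _ _ _ bW (fun q => (s q)%:R * h) _ _.
move=> /(_ (fun q => mulr_ge0 (ler0n _ _) (ltW h0))) mi.
apply: (@mutually_independent2 _ _ 0%N 2%N _ _ (mi _)) => //.
- by move=> q; rewrite ler_pM2r// ler_nat.
- by exists A => //; rewrite setTI.
- by exists B => //; rewrite setTI.
Qed.

(** Increments of length [j] are independent once the lag reaches [j]; for smaller lags they overlap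
    and Cauchy-Schwarz is used. The rates therefore vanish eventually; [2 * v ^+ 2] is the variance
    of the square of a centred normal variable. *)
Lemma brownian_mixing (W : R -> T -> R) j p :
  (forall t, measurable_fun setT (W t)) -> is_brownian_motion P W ->
  mixing_increments P (fun k w => path_increment (W ^~ w) j p k) (j%:R * h).
Proof.
move=> mW bW; pose c k w := path_increment (W ^~ w) j p k.
rewrite -/c.
have mc k : measurable_fun setT (c k) by exact: measurable_funB.
have Nc k : is_normal P (c k) 0 (j%:R * h).
  have := @bm_normal_increments _ _ _ _ _ bW ((k + p)%N%:R * h) ((k + p + j)%N%:R * h).
  have <- : (k + p + j)%N%:R * h - (k + p)%N%:R * h = j%:R * h.
    by rewrite (natrD _ (k + p) j); ring.
  apply; first by rewrite mulr_ge0// ltW.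
  by rewrite ler_pM2r// ler_nat leq_addr.
have M k : [/\ intg (fun w => c k w ^+ 4), mean (c k) = 0,
   mean (fun w => c k w ^+ 2) = j%:R * h & mean (fun w => c k w ^+ 4) = 3 * (j%:R * h) ^+ 2].
  have [] := is_normal_moments (mc k) (Nc k).
  by under [fun w => (_ - 0) ^+ 4]eq_fun do rewrite subr0;
     under [fun w => (_ - 0) ^+ 2]eq_fun do rewrite subr0;
     under [fun w => (_ - 0)]eq_fun do rewrite subr0.
set v := j%:R * h in M *; have v0 : 0 <= v by rewrite mulr_ge0// ltW.
have ic k : intg (fun w => c k w ^+ 4) by have [] := M k.
have sc k := moment4_sqint (mc k) (ic k).
have sU k : sqint (fun w => c k w ^+ 2 - v).
  by apply: sqintB; [exact: moment4_sqr_sqint|exact: sqint_cst].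
have rate (C : R) : (if (i < j)%N then C else 0) @[i --> \oo] --> (0 : R).
  apply: cvg_near_cst; near=> i; rewrite ltnNge.
  by have -> : (j <= i)%N by near: i; exact: nbhs_infty_ge.
split => //.
- exists (fun i => if (i < j)%N then v else 0) => // k i.
  have [ij|ji] := ltnP i j.
    by apply: normr_meanM_le => //; [have [] := M k|have [] := M (k + i)%N].
  rewrite (@mean_indep_comp _ _ _ P (c k) (c (k + i)%N) id id)//.
    by have [_ -> _ _] := M k; rewrite mul0r normr0.
  by move=> A B mA mB; apply: brownian_increments_indep; rewrite ?leq_add2l.
- exists (fun i => if (i < j)%N then 2 * v ^+ 2 else 0) => // k i.
  have U0 l : mean (fun w => c l w ^+ 2 - v) = 0.
    rewrite meanB; [|by case: (sc l)|exact: intg_cst].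
    by have [_ _ -> _] := M l; rewrite mean_cst subrr.
  have U2 l : mean (fun w => (c l w ^+ 2 - v) ^+ 2) = 2 * v ^+ 2.
    have -> : (fun w => (c l w ^+ 2 - v) ^+ 2) =
       (fun w => 1 * c l w ^+ 4 + (- 2 * v) * c l w ^+ 2 + v ^+ 2 * 1).
      by apply/funext => w; ring.
    rewrite mean_lin3//; [|by case: (sc l)|exact: intg_cst].
    by have [_ _ -> ->] := M l; rewrite mean_cst; ring.
  have [ij|ji] := ltnP i j; first exact: normr_meanM_le.
  rewrite (@mean_indep_comp _ _ _ P (c k) (c (k + i)%N) (fun x => x ^+ 2 - v) (fun x => x ^+ 2 - v))//.
  + by rewrite U0 mul0r normr0.
  + by apply: measurable_funB => //; exact: measurable_funX.
  + by apply: measurable_funB => //; exact: measurable_funX.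
  + by move=> A B mA mB; apply: brownian_increments_indep; rewrite ?leq_add2l.
Unshelve. all: by end_near. Qed.

End Brownian.

Section fractional_Brownian.
Context d (T : measurableType d) (R : realType) (P : probability T R).
Local Notation mean := (expect P).
Local Notation intg := (intg P).
Local Notation sqint := (sqint P).
Variables (h H : R) (h0 : 0 < h) (H_range : 2^-1 < H < 1).
Variable X : R -> T -> R.
Hypothesis mX : forall t, measurable_fun setT (X t).
Hypothesis fX : is_fractional_brownian_motion P H X.

Lemma fbm_mean t : 0 <= t -> mean (X t) = 0.
Proof. by move=> /(fbm_centered fX); rewrite unlock /expect /Rintegral => ->. Qed.

Lemma fbm_mean_mul s t : 0 <= s -> 0 <= t ->
  mean (fun w => X s w * X t w) =
  (t `^ (2 * H) + s `^ (2 * H) - `|t - s| `^ (2 * H)) / 2.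
Proof.
move=> s0 t0; have := fbm_covariance fX s0 t0.
rewrite unlock (fbm_centered fX s0) (fbm_centered fX t0) /= unlock => E.
rewrite /expect /Rintegral -[RHS]/(fine (_ %:E)) -E; congr fine.
by apply: eq_integral => w _ /=; rewrite !fctE /= !subr0.
Qed.

Lemma fbm_sqint t : 0 <= t -> sqint (X t).
Proof.
move=> t0; have [m [v]] := fbm_gaussian fX (fun _ : 'I_1 => 1) (fun _ => t0).
under [fun w => _]eq_fun do rewrite big_ord1 mul1r.
move=> /(is_normal_moments (mX t))[_ i2 _ _ _].
have : sqint (fun w => (X t w - m) + m).
  by apply: sqintD; [split => //; exact: measurable_funB|exact: sqint_cst].
by under eq_fun do rewrite subrK.
Qed.

(** Linear combinations are centred normal, with fourth moment three times the squared variance.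
    Applied to sums and differences of increments, this one-dimensional fact yields the mixed fourth
    moments. *)
Lemma fbm_lin k (t a : nat -> R) (Z : T -> R) : (forall i, 0 <= t i) ->
  (forall w, Z w = \sum_(i < k) a i * X (t i) w) ->
  intg (fun w => Z w ^+ 4) /\
  mean (fun w => Z w ^+ 4) = 3 * mean (fun w => Z w ^+ 2) ^+ 2.
Proof.
move=> t0 EZ; have {}EZ : Z = (fun w => \sum_(i < k) a i * X (t i) w) by apply/funext.
have mZ : measurable_fun setT Z.
  rewrite EZ; apply: measurable_sum => i; exact: measurable_funM.
have [m [v]] := fbm_gaussian fX (fun i : 'I_k => a i) (fun i : 'I_k => t0 i).
rewrite -EZ => /(is_normal_moments mZ)[].
have iZ i : intg (fun w => a i * X (t i) w).
  by apply/intgZ/sqint_intg/fbm_sqint.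
have Z0 : mean Z = 0.
  rewrite EZ (mean_sum k iZ) big1// => i _.
  by rewrite meanZ ?fbm_mean ?mulr0//; exact/sqint_intg/fbm_sqint.
have iZ' : intg Z by rewrite EZ; exact: (intg_sum k iZ).
(* The Gaussian law comes with an unknown mean [m]; comparison with [Z0] forces it to be 0. *)
move=> + + + + +; have [->|m0] := eqVneq m 0.
  under [fun w => (_ - 0) ^+ 4]eq_fun do rewrite subr0.
  under [fun w => (_ - 0) ^+ 2]eq_fun do rewrite subr0.
  by move=> i4 i2 _ -> ->.
move=> _ _; rewrite meanB//; last exact: intg_cst.
by rewrite Z0 mean_cst sub0r => /eqP; rewrite oppr_eq0 (negPf m0).
Qed.

(** The increments are stationary with covariance [fgn_cov], and for jointly Gaussian variables the
    covariance of the squares is twice the square of the covariance; both tend to 0. *)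
Lemma fbm_mixing j p :
  mixing_increments P (fun k w => path_increment h (X ^~ w) j p k)
    ((j%:R * h) `^ (2 * H)).
Proof.
case/andP: H_range => H1 H2.
pose c k w := path_increment h (X ^~ w) j p k; rewrite -/c.
pose s k : R := (k + p)%N%:R * h.
have s0 k : 0 <= s k by rewrite mulr_ge0// ltW.
have cE k w : c k w = X (s (k + j)%N) w - X (s k) w.
  by rewrite /c /path_increment /s addnAC.
have mc k : measurable_fun setT (c k) by exact: measurable_funB.
have ck k : intg (fun w => c k w ^+ 4) /\
    mean (fun w => c k w ^+ 4) = 3 * mean (fun w => c k w ^+ 2) ^+ 2.
  apply: (@fbm_lin 2 (fun i => if i is 0 then s (k + j)%N else s k)
    (fun i => if i is 0 then 1 else -1)); first by case.
  by move=> w; rewrite !big_ord_recl big_ord0 /= cE; ring.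
have sc k : sqint (c k) by apply: moment4_sqint => //; case: (ck k).
have cov k i : mean (fun w => c k w * c (k + i)%N w) = fgn_cov (2 * H) h j i.
  have sX a b : intg (fun w => X (s a) w * X (s b) w) by apply: intgM; exact: fbm_sqint.
  have -> : (fun w => c k w * c (k + i)%N w) = (fun w =>
     (X (s (k + j)%N) w * X (s (k + i + j)%N) w - X (s (k + j)%N) w * X (s (k + i)%N) w) -
     (X (s k) w * X (s (k + i + j)%N) w - X (s k) w * X (s (k + i)%N) w)).
    by apply/funext => w; rewrite !cE; ring.
  rewrite meanB; [|exact: intgB|exact: intgB].
  rewrite !meanB// !fbm_mean_mul// /fgn_cov /s.
  have -> : (k + i + j + p)%:R * h - (k + j + p)%:R * h = i%:R * h by rewrite !natrD; ring.
  have -> : (k + i + p)%:R * h - (k + j + p)%:R * h = i%:R * h - j%:R * h by rewrite !natrD; ring.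
  have -> : (k + i + j + p)%:R * h - (k + p)%:R * h = (i + j)%:R * h by rewrite !natrD; ring.
  have -> : (k + i + p)%:R * h - (k + p)%:R * h = i%:R * h by rewrite !natrD; ring.
  rewrite !(@ger0_norm _ (_%:R * h)) ?mulr_ge0 ?(ltW h0)//.
  by field.
set v := _ `^ _.
have cv k : mean (fun w => c k w ^+ 2) = v.
  by have := cov k 0%N; rewrite addn0 fgn_cov0 ?ltW//; rewrite gt_eqF//; lra.
have cvg : fgn_cov (2 * H) h j i @[i --> \oo] --> (0 : R).
  by apply: fgn_cov_cvg0 => //; apply/andP; split; lra.
split => //.
- by move=> k; case: (ck k).
- exists (fun i => `|fgn_cov (2 * H) h j i|); last by move=> k i; rewrite cov.
  by rewrite -(normr0 R); exact: cvg_norm.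
- exists (fun i => 2 * fgn_cov (2 * H) h j i ^+ 2).
    have -> : (0 : R) = 2 * (0 * 0) by rewrite !mulr0.
    by apply: cvgMr; under eq_fun do rewrite expr2; exact: cvgM.
  move=> k i; set l := (k + i)%N.
  have i4 := fun q => (ck q).1.
  have sc2 q : sqint (fun w => c q w ^+ 2) by exact: moment4_sqr_sqint.
  have icc : intg (fun w => c k w ^+ 2 * c l w ^+ 2) by exact: intgM.
  have S e : e ^+ 2 = 1 -> intg (fun w => (c k w + e * c l w) ^+ 4) /\
     mean (fun w => (c k w + e * c l w) ^+ 4) = 3 * (2 * v + 2 * e * fgn_cov (2 * H) h j i) ^+ 2.
    move=> e2.
    have [-> ->] : intg (fun w => (c k w + e * c l w) ^+ 4) /\
       mean (fun w => (c k w + e * c l w) ^+ 4) = 3 * mean (fun w => (c k w + e * c l w) ^+ 2) ^+ 2.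
      apply: (@fbm_lin 4 (fun i => match i with 0 => s (k + j)%N | 1 => s k | 2 => s (l + j)%N | _ => s l end)
        (fun i => match i with 0 => 1 | 1 => -1 | 2 => e | _ => - e end)).
        by case=> [|[|[|]]].
      by move=> w; rewrite !big_ord_recl big_ord0 /= !cE; ring.
    by split => //; rewrite mean_sqrD// !cv cov e2; ring.
  have [ip mp] := S 1 (expr1n _ _).
  have [im mm] := S (-1) (sqrr_sign R 1%N).
  (* Isserlis' formula, from $(x+y)^4+(x-y)^4=2x^4+12x^2y^2+2y^4$, in which every fourth moment
     other than the mixed one is known. *)
  have Ecc : mean (fun w => c k w ^+ 2 * c l w ^+ 2) = v ^+ 2 + 2 * fgn_cov (2 * H) h j i ^+ 2.
    have : mean (fun w => 2 * c k w ^+ 4 + 12 * (c k w ^+ 2 * c l w ^+ 2) + 2 * c l w ^+ 4) =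
       mean (fun w => (c k w + 1 * c l w) ^+ 4) + mean (fun w => (c k w + (-1) * c l w) ^+ 4).
      by rewrite -meanD//; congr expect; apply/funext => w; ring.
    rewrite mean_lin3// mp mm (ck k).2 (ck l).2 !cv => E; lra.
  have -> : mean (fun w => (c k w ^+ 2 - v) * (c l w ^+ 2 - v)) = 2 * fgn_cov (2 * H) h j i ^+ 2.
    have -> : (fun w => (c k w ^+ 2 - v) * (c l w ^+ 2 - v)) =
      (fun w => (1 * (c k w ^+ 2 * c l w ^+ 2) + (- v) * c k w ^+ 2 + (- v) * c l w ^+ 2) + v ^+ 2).
      by apply/funext => w; ring.
    have ic2 q : intg (fun w => c q w ^+ 2) by case: (sc q).
    rewrite meanD; [|exact: intg_lin3|exact: intg_cst].
    by rewrite mean_lin3// mean_cst Ecc !cv; ring.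
  by rewrite ger0_norm// mulr_ge0// sqr_ge0.
Qed.

End fractional_Brownian.

(** * Choice of the number of observations *)

Section vanishing.
Context d (T : measurableType d) (R : realType) (P : probability T R).
Local Notation mean := (expect P).
Local Notation intg := (intg P).
Local Notation sqint := (sqint P).

Record vanishing (Z : nat -> T -> R) : Prop := {
  vanishing_intg : forall n, intg (Z n) ;
  vanishing_ge0 : forall n w, 0 <= Z n w ;
  vanishing_cvg : mean (Z n) @[n --> \oo] --> (0 : R)
}.

Lemma vanishingD Z1 Z2 : vanishing Z1 -> vanishing Z2 ->
  vanishing (fun n w => Z1 n w + Z2 n w).
Proof.
move=> [i1 p1 c1] [i2 p2 c2]; split => [n|n w|].
- exact: intgD.
- exact: addr_ge0.
- have -> : (fun n => mean (fun w => Z1 n w + Z2 n w)) = (fun n => mean (Z1 n) + mean (Z2 n)).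
    by apply/funext => n; rewrite meanD.
  by rewrite -[X in _ --> X](addr0 (0 : R)); exact: cvgD.
Qed.

Lemma vanishing_sum m (Z : nat -> nat -> T -> R) : (forall k, vanishing (Z k)) ->
  vanishing (fun n w => \sum_(k < m) Z k n w).
Proof.
move=> vZ; elim: m => [|m IH].
  split=> [n|n w|].
  - by under eq_fun do rewrite big_ord0; exact: intg_cst.
  - by rewrite big_ord0.
  - under eq_fun do under [fun w => _]eq_fun do rewrite big_ord0.
    by under eq_fun do rewrite mean_cst; exact: cvg_cst.
have -> : (fun n w => \sum_(k < m.+1) Z k n w) = (fun n w => \sum_(k < m) Z k n w + Z m n w).
  by apply/funext => n; apply/funext => w; rewrite big_ord_recr.
exact: vanishingD.
Qed.

Lemma vanishing_average (U : nat -> T -> R) : (forall k, sqint (U k)) ->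
  mean (fun w => average n (U ^~ w) ^+ 2) @[n --> \oo] --> (0 : R) ->
  vanishing (fun n w => average n (U ^~ w) ^+ 2).
Proof.
move=> sU cU; split => // [n|n w]; last exact: sqr_ge0.
by have [_] := sqintZ (n%:R^-1) (sqint_sum n sU).
Qed.

Lemma vanishing_mixing c1 v1 c2 v2 :
  mixing_increments P c1 v1 -> mixing_increments P c2 v2 ->
  (forall k l, mean (fun w => (c1 k w * c1 l w) * (c2 k w * c2 l w)) =
     mean (fun w => c1 k w * c1 l w) * mean (fun w => c2 k w * c2 l w)) ->
  vanishing (fun n w =>
    average n (c1 ^~ w) ^+ 2 + average n (c2 ^~ w) ^+ 2 +
    average n (fun k => c1 k w * c2 k w) ^+ 2 +
    average n (fun k => c1 k w ^+ 2 - v1) ^+ 2 +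
    average n (fun k => c2 k w ^+ 2 - v2) ^+ 2).
Proof.
move=> m1 m2 E; have [mc1 ic1 _ _] := m1; have [mc2 ic2 _ _] := m2.
have s1 k := moment4_sqint (mc1 k) (ic1 k).
have s2 k := moment4_sqint (mc2 k) (ic2 k).
apply: vanishingD; last first.
  apply: (@vanishing_average (fun k w => c2 k w ^+ 2 - v2)); last exact: mixing_average_sqr_cvg0.
  by move=> k; apply: sqintB; [exact: moment4_sqr_sqint|exact: sqint_cst].
apply: vanishingD; last first.
  apply: (@vanishing_average (fun k w => c1 k w ^+ 2 - v1)); last exact: mixing_average_sqr_cvg0.
  by move=> k; apply: sqintB; [exact: moment4_sqr_sqint|exact: sqint_cst].
apply: vanishingD; last first.
  apply: (@vanishing_average (fun k w => c1 k w * c2 k w)); last exact: mixing_average_mul_cvg0 m1 m2 E.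
  by move=> k; exact: sqintM.
apply: vanishingD.
  by apply: (@vanishing_average c1) => //; exact: mixing_average_cvg0 m1.
by apply: (@vanishing_average c2) => //; exact: mixing_average_cvg0 m2.
Qed.

Lemma sum_half n : \sum_(k < n) (2^-1 : R) ^+ k <= 2.
Proof.
suff -> : \sum_(k < n) (2^-1 : R) ^+ k = 2 - 2 * 2^-1 ^+ n.
  by rewrite gerBl mulr_ge0// exprn_ge0.
elim: n => [|n IH]; first by rewrite big_ord0 expr0; lra.
by rewrite big_ord_recr /= IH exprS; field.
Qed.

(** The choice depends on means only, so [n] is deterministic. The bound [N < n N] makes [n N] tend
    to infinity and excludes empty averages. *)
Lemma vanishing_diagonal (Z : nat -> nat -> T -> R) :
  (forall i, vanishing (Z i)) ->
  exists n : nat -> nat, (forall N, (N < n N)%N) /\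
    {ae P, forall w, \sum_(i < N) Z i (n N) w @[N --> \oo] --> (0 : R)}.
Proof.
move=> vZ; pose S N n w := \sum_(i < N) Z i n w.
have vS N : vanishing (S N) by exact: (vanishing_sum N vZ).
have /choice[n hn] : forall N, exists n, (N < n)%N /\ mean (S N n) <= 2^-1 ^+ N.
  move=> N; have e0 : 0 < (2^-1 : R) ^+ N by rewrite exprn_gt0.
  have [_ _ /cvgr0Pnorm_le /(_ _ e0) [k _ hk]] := vS N.
  exists (maxn k N.+1); split; first exact: leq_maxr.
  by apply: le_trans (ler_norm _) _; apply: hk => /=; exact: leq_maxl.
exists n; split; first by move=> N; have [] := hn N.
apply: (@ae_cvg0_of_mean _ _ _ P (fun N => S N (n N)) 2).
- by move=> k; have [] := vS k.
- by move=> k w; have [] := vS k.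
- move=> k; apply: le_trans (sum_half k); apply: ler_sum => N _.
  by have [] := hn N.
Qed.

End vanishing.

Section noise.
Context d (T : measurableType d) (R : realType) (P : probability T R).
Variables (h H : R) (h0 : 0 < h) (H_range : 2^-1 < H < 1).

(* Gathers every quantity that the ergodic theorem sends to 0, so that the
   statistics of the paths are deterministic continuous functions of it. *)
Definition noise_defect n (a b : R -> R) : R :=
  \sum_(j < 5) \sum_(p < 3)
   (average n (path_increment h a j p) ^+ 2 +
    average n (path_increment h b j p) ^+ 2 +
    average n (fun k => path_increment h a j p k * path_increment h b j p k) ^+ 2 +
    average n (fun k => path_increment h a j p k ^+ 2 - j%:R * h) ^+ 2 +
    average n (fun k => path_increment h b j p k ^+ 2 - (j%:R * h) `^ (2 * H)) ^+ 2).

(** The sample space is given the sigma-algebra generated by the process, for which the product of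
    increments is measurable. Independence of the two processes then applies to such products. *)
Lemma sigma_of_path_increment_mul (W : R -> T -> R) j p k l (A : set R) :
  measurable A ->
  sigma_of [set t : R | 0 <= t] W ((fun w =>
    path_increment h (W ^~ w) j p k * path_increment h (W ^~ w) j p l) @^-1` A).
Proof.
move=> mA; rewrite /sigma_of.
set G := \bigcup_(t in _) _.
have mW (t : R) : 0 <= t -> measurable_fun (setT : set (g_sigma_algebraType G)) (W t).
  move=> t0 _ B mB; apply: sub_gen_smallest; exists t => //.
  by exists B.
have mI q : measurable_fun (setT : set (g_sigma_algebraType G))
    (fun w => path_increment h (W ^~ w) j p q).
  by apply: measurable_funB; apply: mW; rewrite mulr_ge0// ltW.
have := measurable_funM (mI k) (mI l) measurableT mA.
by rewrite setTI.
Qed.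

Lemma noise_vanishing (W X : R -> T -> R) :
  (forall t, measurable_fun setT (W t)) -> (forall t, measurable_fun setT (X t)) ->
  is_brownian_motion P W -> is_fractional_brownian_motion P H X ->
  (forall A1 A2, sigma_of [set t : R | 0 <= t] W A1 ->
     sigma_of [set t : R | 0 <= t] X A2 -> P (A1 `&` A2) = (P A1 * P A2)%E) ->
  vanishing P (fun n w => noise_defect n (W ^~ w) (X ^~ w)).
Proof.
move=> mW mX bW fX indep.
pose c1 j p (k : nat) w := path_increment h (W ^~ w) j p k.
pose c2 j p (k : nat) w := path_increment h (X ^~ w) j p k.
pose D j p n w : R := average n (c1 j p ^~ w) ^+ 2 + average n (c2 j p ^~ w) ^+ 2 +
    average n (fun k => c1 j p k w * c2 j p k w) ^+ 2 +
    average n (fun k => c1 j p k w ^+ 2 - j%:R * h) ^+ 2 +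
    average n (fun k => c2 j p k w ^+ 2 - (j%:R * h) `^ (2 * H)) ^+ 2.
apply: (@vanishing_sum _ _ _ P 5 (fun j n w => \sum_(p < 3) D j p n w)) => j.
apply: (@vanishing_sum _ _ _ P 3 (D j)) => p.
have m1 := brownian_mixing h0 j p mW bW.
have m2 := fbm_mixing h0 H_range mX fX j p.
apply: (@vanishing_mixing _ _ _ P (c1 j p) (j%:R * h) (c2 j p) ((j%:R * h) `^ (2 * H))) => // k l.
case: m1 => mc1 ic1 _ _; case: m2 => mc2 ic2 _ _.
apply: mean_indep.
- exact: (sqintM (mc1 k) (ic1 k) (mc1 l) (ic1 l)).
- exact: (sqintM (mc2 k) (ic2 k) (mc2 l) (ic2 l)).
- by move=> A B mA mB; apply: indep; exact: sigma_of_path_increment_mul.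
Qed.

End noise.

(** * Deterministic consistency of the estimators *)

Section averages.
Variable R : realType.
Implicit Types (u v : nat -> R) (c : R).

Lemma eq_average n u v : (forall k, (k < n)%N -> u k = v k) -> average n u = average n v.
Proof. by move=> uv; congr (_ * _); apply: eq_bigr => i _; exact: uv. Qed.

Lemma averageD n u v : average n (fun k => u k + v k) = average n u + average n v.
Proof. by rewrite /average big_split mulrDr. Qed.

Lemma averageZ n c u : average n (fun k => c * u k) = c * average n u.
Proof. by rewrite /average -mulr_sumr mulrCA. Qed.

Lemma averageB n u v : average n (fun k => u k - v k) = average n u - average n v.
Proof. by rewrite /average sumrB mulrBr. Qed.

Lemma average_cst n c : (0 < n)%N -> average n (fun=> c) = c.
Proof.
move=> n0; rewrite /average sumr_const card_ord -[c *+ n]mulr_natl mulKf//.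
by rewrite pnatr_eq0 -lt0n.
Qed.

Lemma le_average n u v : (forall k, (k < n)%N -> u k <= v k) -> average n u <= average n v.
Proof.
by move=> uv; rewrite ler_wpM2l ?invr_ge0//; apply: ler_sum => i _; exact: uv.
Qed.

Lemma average_dist n u c (e : R) : (0 < n)%N -> (forall k, (k < n)%N -> `|u k - c| <= e) ->
  `|average n u - c| <= e.
Proof.
move=> n0 ue; rewrite -{1}(average_cst c n0) -averageB /average normrM.
rewrite ger0_norm ?invr_ge0//; apply: (@le_trans _ _ (average n (fun=> e))).
  rewrite /average ler_wpM2l ?invr_ge0//; apply: le_trans (ler_norm_sum _ _ _) _.
  by apply: ler_sum => i _; exact: ue.
by rewrite average_cst.
Qed.

Lemma cvg_of_dist u c (e : nat -> R) : e n @[n --> \oo] --> (0 : R) ->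
  (\forall n \near \oo, `|u n - c| <= e n) -> u n @[n --> \oo] --> c.
Proof.
move=> e0 ue; apply/subr_cvg0; apply/norm_cvg0P.
apply: (@squeeze_cvgr _ _ _ _ (fun=> 0) e) => //; last exact: cvg_cst.
by near=> n; rewrite normr_ge0 /=; near: n.
Unshelve. all: by end_near. Qed.

End averages.

(** * Error bounds for the statistics and limits of the estimators *)

Section statistics.
Variables (R : realType) (h H sigma gamma : R).
Hypotheses (h0 : 0 < h) (H_range : 2^-1 < H < 1) (s0 : 0 < sigma) (g0 : 0 < gamma).
Local Notation q := (2 `^ (2 * H)).
Local Notation g := (h `^ (2 * H)).

Lemma noise_defect_bounds n (a b : R -> R) (j p : nat) (e : R) :
  0 <= e -> (j < 5)%N -> (p < 3)%N -> noise_defect h H n a b <= e ^+ 2 ->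
  [/\ `|average n (path_increment h a j p)| <= e,
      `|average n (path_increment h b j p)| <= e,
      `|average n (fun k => path_increment h a j p k * path_increment h b j p k)| <= e,
      `|average n (fun k => path_increment h a j p k ^+ 2 - j%:R * h)| <= e &
      `|average n (fun k => path_increment h b j p k ^+ 2 - (j%:R * h) `^ (2 * H))| <= e].
Proof.
move=> e0 j5 p3; rewrite /noise_defect (bigD1 (Ordinal j5))//= (bigD1 (Ordinal p3))//=.
set s1 := \sum_(i < 3 | _) _; set s2 := \sum_(i < 5 | _) _ => hs.
have s10 : 0 <= s1 by apply: sumr_ge0 => i _; rewrite !addr_ge0// sqr_ge0.
have s20 : 0 <= s2.
  by apply: sumr_ge0 => i _; apply: sumr_ge0 => i' _; rewrite !addr_ge0// sqr_ge0.
move: hs; set u1 := average _ _; set u2 := average _ _; set u3 := average _ _.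
set u4 := average _ _; set u5 := average _ _ => hs.
have [p1 p2 p3' p4 p5] : [/\ 0 <= u1 ^+ 2, 0 <= u2 ^+ 2, 0 <= u3 ^+ 2, 0 <= u4 ^+ 2 &
   0 <= u5 ^+ 2] by split; exact: sqr_ge0.
by split; rewrite -ler_sqr ?nnegrE// real_normK ?num_real//; lra.
Qed.

Lemma path_increment_line theta (a b : R -> R) j p k :
  path_increment h (fun t => theta * t + (sigma * a t + gamma * b t)) j p k =
  theta * (j%:R * h) +
  (sigma * path_increment h a j p k + gamma * path_increment h b j p k).
Proof. by rewrite /path_increment (natrD _ (k + p) j); ring. Qed.

(** The square of drift plus noise is expanded, each noise average being within [e] of its limit.
    The 10 is twice the crude bound 5 on the lag [j]. *)
Lemma average_sqr_path n (theta : R) (a b : R -> R) j p (e Th : R) :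
  (0 < n)%N -> (j < 5)%N -> (p < 3)%N -> 0 <= e -> `|theta| <= Th ->
  noise_defect h H n a b <= e ^+ 2 ->
  `|average n (fun k =>
       path_increment h (fun t => theta * t + (sigma * a t + gamma * b t)) j p k ^+ 2)
    - ((theta * (j%:R * h)) ^+ 2 + sigma ^+ 2 * (j%:R * h) +
       gamma ^+ 2 * (j%:R * h) `^ (2 * H))| <=
  (sigma ^+ 2 + gamma ^+ 2 + 2 * sigma * gamma + 10 * h * Th * (sigma + gamma)) * e.
Proof.
move=> n0 j5 p3 e0 Tth hs.
have [b1 b2 b3 b4 b5] := noise_defect_bounds e0 j5 p3 hs.
move: b1 b2 b3 b4 b5.
set A := average _ (path_increment h a j p); set B := average _ (path_increment h b j p).
rewrite !averageB !average_cst//.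
set AB := average _ (fun k => _ * _); set AA := average _ _; set BB := average _ _.
move=> b1 b2 b3 b4 b5.
have -> : average n (fun k =>
    path_increment h (fun t => theta * t + (sigma * a t + gamma * b t)) j p k ^+ 2) =
   (theta * (j%:R * h)) ^+ 2 + (2 * theta * (j%:R * h) * (sigma * A + gamma * B) +
    (sigma ^+ 2 * AA + gamma ^+ 2 * BB + 2 * sigma * gamma * AB)).
  rewrite /A /B /AA /BB /AB -!averageZ -!averageD -(average_cst (_ ^+ 2) n0) -!averageZ.
  rewrite -!averageD.
  by apply: eq_average => k _; rewrite path_increment_line; ring.
have j5' : j%:R <= 5 :> R by rewrite (ler_nat _ j 5) ltnW.
have Th0 : 0 <= Th by exact: le_trans Tth.
have J : `|2 * theta * (j%:R * h)| <= 10 * h * Th.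
  rewrite !normrM (@ger0_norm _ 2)// (@ger0_norm _ j%:R)// (gtr0_norm h0).
  rewrite (_ : 10 * h * Th = 2 * Th * (5 * h)); last by ring.
  by rewrite ler_pM// ?mulr_ge0 ?(ltW h0)// ?ler_pM2l// ler_pM2r.
rewrite [X in `|X|](_ : _ = 2 * theta * (j%:R * h) * (sigma * A + gamma * B) +
   (sigma ^+ 2 * (AA - j%:R * h) + gamma ^+ 2 * (BB - (j%:R * h) `^ (2 * H)) +
    2 * sigma * gamma * AB)); last by ring.
have N1 : `|sigma * A + gamma * B| <= (sigma + gamma) * e.
  apply: le_trans (ler_normD _ _) _; rewrite (normrM sigma) (normrM gamma) (gtr0_norm s0) (gtr0_norm g0) mulrDl.
  by rewrite lerD// ler_pM2l.
have N2 : `|sigma ^+ 2 * (AA - j%:R * h) + gamma ^+ 2 * (BB - (j%:R * h) `^ (2 * H)) +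
    2 * sigma * gamma * AB| <= (sigma ^+ 2 + gamma ^+ 2 + 2 * sigma * gamma) * e.
  have t1 : `|sigma ^+ 2 * (AA - j%:R * h)| <= sigma ^+ 2 * e.
    by rewrite normrM ger0_norm ?sqr_ge0// ler_wpM2l// sqr_ge0.
  have t2 : `|gamma ^+ 2 * (BB - (j%:R * h) `^ (2 * H))| <= gamma ^+ 2 * e.
    by rewrite normrM ger0_norm ?sqr_ge0// ler_wpM2l// sqr_ge0.
  have sg0 : 0 < 2 * sigma * gamma by rewrite !mulr_gt0.
  have t3 : `|2 * sigma * gamma * AB| <= 2 * sigma * gamma * e.
    by rewrite (normrM (2 * sigma * gamma)) (gtr0_norm sg0) ler_pM2l.
  apply: le_trans (ler_normD _ _) _.
  have := ler_normD (sigma ^+ 2 * (AA - j%:R * h)) (gamma ^+ 2 * (BB - (j%:R * h) `^ (2 * H))).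
  lra.
have t4 : `|2 * theta * (j%:R * h) * (sigma * A + gamma * B)| <=
    10 * h * Th * ((sigma + gamma) * e) by rewrite (normrM (2 * theta * (j%:R * h))) ler_pM.
apply: le_trans (ler_normD _ _) _; lra.
Qed.

(** Two adjacent increments add up to one of double length, so polarization expresses [eta] and
    [zeta] by averages of squares. The Brownian variance is additive in the length and cancels; the
    fractional one is multiplied by [q] at each doubling, whence the factor [q / 2 - 1] and the
    ratio [q] of the two limits. The constant is uniform in [theta], so averages over subjects keep
    the bound. *)
Lemma statistics_error (Th : R) : 0 <= Th -> exists2 C, 0 <= C &
  forall n (theta : R) (a b : R -> R) (e : R), (0 < n)%N -> 0 <= e <= 1 -> `|theta| <= Th ->
    noise_defect h H n a b <= e ^+ 2 ->
    let y := fun t => theta * t + (sigma * a t + gamma * b t) in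
    let V := theta_hat h n y ^+ 2 in
    [/\ `|theta_hat h n y - theta| <= C * e,
        `|xi h n y - h ^+ 2 * V - (sigma ^+ 2 * h + gamma ^+ 2 * g)| <= C * e,
        `|eta h n y - h ^+ 2 * V - gamma ^+ 2 * g * (q / 2 - 1)| <= C * e &
        `|zeta h n y - 4 * h ^+ 2 * V - gamma ^+ 2 * g * q * (q / 2 - 1)| <= C * e].
Proof.
move=> Th0.
pose C1 := sigma ^+ 2 + gamma ^+ 2 + 2 * sigma * gamma + 10 * h * Th * (sigma + gamma).
pose S := sigma + gamma.
pose C2 := S ^+ 2 + 2 * h * Th * S.
have S0 : 0 <= S by rewrite addr_ge0// ltW.
have C20 : 0 <= C2 by rewrite addr_ge0// ?sqr_ge0// !mulr_ge0// ltW.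
have C10 : 0 <= C1.
  by rewrite !addr_ge0// ?sqr_ge0// !mulr_ge0// ?(ltW s0) ?(ltW g0) ?(ltW h0)//.
have Sh0 : 0 <= S / h by rewrite divr_ge0// ltW.
exists (S / h + 3 * C1 + 4 * C2); first by lra.
move=> n theta a b e n0 /andP[e0 e1] Tth hs y V.
have n0' : n%:R != 0 :> R by rewrite pnatr_eq0 -lt0n.
have Q j p (j5 : (j < 5)%N) (p3 : (p < 3)%N) := average_sqr_path n0 j5 p3 e0 Tth hs.
have [b1 b2 _ _ _] := @noise_defect_bounds n a b 1 0 e e0 isT isT hs.
pose M := sigma * average n (path_increment h a 1 0) + gamma * average n (path_increment h b 1 0).
have Me : `|M| <= S * e.
  apply: le_trans (ler_normD _ _) _; rewrite (normrM sigma) (normrM gamma) (gtr0_norm s0) (gtr0_norm g0) [S * e]mulrDl.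
  by rewrite lerD// ler_pM2l.
have inc k : increment h y k = path_increment h y 1 0 k.
  by rewrite /increment /path_increment addn0 addn1.
have ET : theta_hat h n y = theta + M / h.
  have -> : theta_hat h n y = h^-1 * average n (path_increment h y 1 0).
    rewrite /theta_hat /average invfM mulrA [h^-1 * _]mulrC.
    by congr (_ * _); apply: eq_bigr => k _; exact: inc.
  have -> : average n (path_increment h y 1 0) = theta * h + M.
    rewrite /M -!averageZ -averageD -(average_cst (theta * h) n0) -averageD.
    by apply: eq_average => k _; rewrite path_increment_line mul1r.
  by field; rewrite gt_eqF.
have h0n : h != 0 by rewrite gt_eqF.
have EV : h ^+ 2 * V = (h * theta + M) ^+ 2 by rewrite /V ET; field.
(* [e <= 1] turns the quadratic error [M ^+ 2] into a linear one. *)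
have hV : `|h ^+ 2 * V - h ^+ 2 * theta ^+ 2| <= C2 * e.
  rewrite EV (_ : _ - _ = (M + 2 * h * theta) * M); last by ring.
  rewrite normrM /C2 expr2.
  have : `|M + 2 * h * theta| <= S + 2 * h * Th.
    apply: le_trans (ler_normD _ _) _; apply: lerD.
      by apply: le_trans Me _; rewrite -[leRHS]mulr1 ler_wpM2l.
    by rewrite !normrM (@ger0_norm _ 2)// (gtr0_norm h0) ler_pM2l// mulr_gt0.
  move=> hM; rewrite (_ : (S * S + 2 * h * Th * S) * e = (S + 2 * h * Th) * (S * e)); last by ring.
  by rewrite ler_pM.
have Exi : xi h n y = average n (fun k => path_increment h y 1 0 k ^+ 2).
  by rewrite /xi /average; congr (_ * _); apply: eq_bigr => k _; rewrite inc.
have Eeta : eta h n y = 2^-1 * (average n (fun k => path_increment h y 2 0 k ^+ 2) -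
    average n (fun k => path_increment h y 1 0 k ^+ 2) -
    average n (fun k => path_increment h y 1 1 k ^+ 2)).
  rewrite -!averageB -averageZ.
  rewrite /eta -/(average n (fun k => increment h y k * increment h y k.+1)).
  apply: eq_average => k _; rewrite /increment /path_increment !addn0 !addn1 !addn2; by field.
have Ezeta : zeta h n y = 2^-1 * (average n (fun k => path_increment h y 4 0 k ^+ 2) -
    average n (fun k => path_increment h y 2 0 k ^+ 2) -
    average n (fun k => path_increment h y 2 2 k ^+ 2)).
  rewrite -!averageB -averageZ.
  rewrite /zeta -/(average n (fun k => (y (k.+2%:R * h) - y (k%:R * h)) *
    (y (k.+4%:R * h) - y (k.+2%:R * h)))).
  apply: eq_average => k _; rewrite /path_increment !addn0 !addn2 addn4; by field.
have p2 : (2%:R * h) `^ (2 * H) = q * g by rewrite powRM// ltW.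
have p4 : (4%:R * h) `^ (2 * H) = q * q * g.
  have -> : 4%:R * h = 2 * (2 * h) :> R by ring.
  by rewrite !powRM// ?mulr_ge0 ?(ltW h0)// mulrA.
have D1 := Q 1%N 0%N isT isT; have D11 := Q 1%N 1%N isT isT.
have D2 := Q 2%N 0%N isT isT; have D22 := Q 2%N 2%N isT isT.
have D4 := Q 4%N 0%N isT isT.
rewrite -/C1 -/y in D1 D11 D2 D22 D4.
rewrite !mul1r in D1 D11; rewrite p2 in D2 D22; rewrite p4 in D4.
move: Exi Eeta Ezeta.
move: D1 D11 D2 D22 D4.
set x1 := average _ _; set x11 := average _ _; set x2 := average _ _.
set x22 := average _ _; set x4 := average _ _.
move=> D1 D11 D2 D22 D4 -> -> ->.
have hC : 0 <= C1 * e /\ 0 <= C2 * e /\ 0 <= S / h * e.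
  by split; [|split]; apply: mulr_ge0.
case: hC => hC1 [hC2 hS].
have W : 4 * h ^+ 2 * V = 4 * (h ^+ 2 * V) by ring.
rewrite W; move: hV; set v := h ^+ 2 * V => hV.
move: D1 D11 D2 D22 D4 hV; rewrite !ler_norml.
move=> /andP[? ?] /andP[? ?] /andP[? ?] /andP[? ?] /andP[? ?] /andP[? ?].
split.
- have : `|M| / h <= S / h * e by rewrite mulrAC ler_pM2r ?invr_gt0.
  rewrite -{1}(gtr0_norm h0) -normfV -normrM ET ler_norml => /andP[? ?].
  by apply/andP; split; lra.
- by apply/andP; split; lra.
- by apply/andP; split; lra.
- by apply/andP; split; lra.
Qed.

(** Here $H>\frac12$ keeps the limiting denominators of [H_hat] and [gamma2_hat] away from 0. *)
Lemma hurst_gap : 0 < q / 2 - 1.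
Proof.
case/andP: H_range => H1 _.
rewrite subr_gt0 ltr_pdivlMr// mul1r -{1}(@powRr1 _ 2)// /powR gt_eqF//.
by rewrite ltr_expR ltr_pM2r ?ln_gt0//; lra.
Qed.

Lemma cvg_powR_exponent (x : R) (u : nat -> R) (l : R) : 0 < x ->
  u n @[n --> \oo] --> l -> x `^ u n @[n --> \oo] --> x `^ l.
Proof.
move=> x0 ul; rewrite /powR gt_eqF//.
apply: (@cvg_comp _ _ _ (fun n => u n * ln x) expR); last exact: continuous_expR.
by apply: cvgMl.
Qed.

(** [ln] is 0 on nonpositive arguments, in agreement with the truncation, so continuity of [ln] at
    the positive limit applies directly. *)
Lemma log2_plusE (x : R) : log2_plus x = ln x / ln 2.
Proof. by rewrite /log2_plus; case: ltP => // x0; rewrite ln0// mul0r. Qed.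

Section estimators.
Variables (n : nat -> nat) (Y : nat -> R -> R).
Hypothesis cxi : xi_bar h (n N) N Y - h ^+ 2 * V_bar h (n N) N Y
  @[N --> \oo] --> sigma ^+ 2 * h + gamma ^+ 2 * g.
Hypothesis ceta : eta_bar h (n N) N Y - h ^+ 2 * V_bar h (n N) N Y
  @[N --> \oo] --> gamma ^+ 2 * g * (q / 2 - 1).
Hypothesis czeta : zeta_bar h (n N) N Y - 4 * h ^+ 2 * V_bar h (n N) N Y
  @[N --> \oo] --> gamma ^+ 2 * g * q * (q / 2 - 1).

Lemma H_hat_cvg : H_hat h (n N) N Y @[N --> \oo] --> H.
Proof.
have q0 : 0 < q by rewrite powR_gt0.
have c0 : gamma ^+ 2 * g * (q / 2 - 1) != 0.
  by rewrite gt_eqF// mulr_gt0 ?hurst_gap// mulr_gt0 ?powR_gt0// exprn_gt0.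
have -> : H = 2^-1 * (ln q / ln 2).
  rewrite ln_powR mulfK ?mulrA ?mulVf ?mul1r//.
  by rewrite gt_eqF// ln_gt0//; lra.
rewrite /H_hat; apply: cvgMr; under eq_fun do rewrite log2_plusE.
apply: cvgMl.
apply: (@cvg_comp _ _ _ _ (@ln R)); last exact: continuous_ln.
have -> : q = gamma ^+ 2 * g * q * (q / 2 - 1) / (gamma ^+ 2 * g * (q / 2 - 1)).
  move: c0; rewrite !mulf_eq0 !negb_or => /andP[/andP[? ?] ?].
  by field; rewrite ?mulf_neq0//; lra.
by apply: cvgM => //; apply: cvgV.
Qed.

Lemma gamma2_hat_cvg : gamma2_hat h (n N) N Y @[N --> \oo] --> gamma ^+ 2.
Proof.
have gt0g : 0 < g by rewrite powR_gt0.
have q2 : 2 `^ (2 * H - 1) = q / 2 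
    by rewrite powRB ?powRr1// (_ : (2 : R) != 0) ?implybT// gt_eqF.
have E : gamma ^+ 2 = gamma ^+ 2 * g * (q / 2 - 1) / (g * (2 `^ (2 * H - 1) - 1)).
  by rewrite q2; field; rewrite !gt_eqF//=; have := hurst_gap; lra.
rewrite E; apply: cvgM => //; apply: cvgV.
  by rewrite q2 gt_eqF// mulr_gt0// hurst_gap.
have c2 : 2 * H_hat h (n N) N Y @[N --> \oo] --> 2 * H by apply: cvgMr; exact: H_hat_cvg.
apply: cvgM; first exact: cvg_powR_exponent.
apply: cvgB; last exact: cvg_cst.
apply: cvg_powR_exponent => //.
by apply: cvgB => //; exact: cvg_cst.
Qed.

Lemma sigma2_hat_cvg : sigma2_hat h (n N) N Y @[N --> \oo] --> sigma ^+ 2.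
Proof.
have E : sigma ^+ 2 = (sigma ^+ 2 * h + gamma ^+ 2 * g - gamma ^+ 2 * g) / h.
  by rewrite addrK mulfK// gt_eqF.
rewrite E /sigma2_hat; apply: cvgMl; apply: cvgB => //.
apply: cvgM; first exact: gamma2_hat_cvg.
by apply: cvg_powR_exponent => //; apply: cvgMr; exact: H_hat_cvg.
Qed.

End estimators.

(** Each defect is at most the total, whose square root [e N] is one error scale for all [N]
    subjects. The other part of [delta] is the error of [sigma2_hat], which is common to the
    subjects; hence the uniformity in [i]. *)
Lemma phi_hat_uniform_cvg (n : nat -> nat) (a b : nat -> R -> R) (phi : nat -> R) :
  (forall i, `|phi i| <= 1) -> (forall N, (0 < n N)%N) ->
  \sum_(i < N) noise_defect h H (n N) (a i) (b i) @[N --> \oo] --> (0 : R) ->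
  let Y := fun i t => (phi i - sigma ^+ 2 / 2) * t + (sigma * a i t + gamma * b i t) in
  exists2 delta : nat -> R, delta N @[N --> \oo] --> (0 : R) &
    \forall N \near \oo, forall i, (i < N)%N ->
      `|phi_hat h (n N) N Y i - phi i| <= delta N.
Proof.
move=> phi1 n0 D0 Y.
pose D N := \sum_(i < N) noise_defect h H (n N) (a i) (b i).
have nd_ge0 N i : 0 <= noise_defect h H (n N) (a i) (b i).
  by apply: sumr_ge0 => j _; apply: sumr_ge0 => p _; rewrite !addr_ge0// sqr_ge0.
have D_ge0 N : 0 <= D N by apply: sumr_ge0.
pose e N := Num.sqrt (D N).
have e0 : e N @[N --> \oo] --> (0 : R).
  apply/cvgr0Pnorm_le => t t0.
  have t20 : 0 < t ^+ 2 by rewrite exprn_gt0.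
  have /cvgr0Pnorm_le /(_ _ t20) Dt := D0.
  near=> N; rewrite ger0_norm ?sqrtr_ge0// -ler_sqr ?nnegrE ?sqrtr_ge0 ?(ltW t0)// sqr_sqrtr//.
  by rewrite -[D N]ger0_norm//; near: N; exact: Dt.
have e_ge0 N : 0 <= e N by rewrite sqrtr_ge0.
have De N i : (i < N)%N -> noise_defect h H (n N) (a i) (b i) <= e N ^+ 2.
  move=> iN; rewrite sqr_sqrtr// /D (bigD1 (Ordinal iN))//= lerDl.
  by apply: sumr_ge0.
pose Th := 1 + sigma ^+ 2 / 2.
have s2 : 0 <= sigma ^+ 2 / 2 by rewrite divr_ge0// sqr_ge0.
have th i : `|phi i - sigma ^+ 2 / 2| <= Th.
  by apply: le_trans (ler_normB _ _) _; rewrite (ger0_norm s2) lerD2r.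
have [C C0 HC] := statistics_error (addr_ge0 ler01 s2 : 0 <= Th).
have e1 : \forall N \near \oo, (0 < N)%N /\ e N <= 1.
  have /cvgr0Pnorm_le /(_ _ ltr01) h1 := e0.
  near=> N; split; first by near: N; exact: nbhs_infty_gt.
  by rewrite -(ger0_norm (e_ge0 N)); near: N; exact: h1.
have Ce0 : C * e N @[N --> \oo] --> (0 : R) by rewrite -(mulr0 C); exact: cvgMr.
have bar (F1 F2 : nat -> (R -> R) -> R) (k c : R) :
    (forall N i, (i < N)%N -> e N <= 1 -> `|F1 (n N) (Y i) - k * F2 (n N) (Y i) - c| <= C * e N) ->
    average N (fun i => F1 (n N) (Y i)) - k * average N (fun i => F2 (n N) (Y i))
      @[N --> \oo] --> c.
  move=> HF; apply: (cvg_of_dist Ce0).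
  near=> N; have [N0 eN1] : (0 < N)%N /\ e N <= 1 by near: N.
  by rewrite -averageZ -averageB; apply: average_dist => // i iN; exact: HF.
have err N i (iN : (i < N)%N) (eN1 : e N <= 1) :=
  HC (n N) _ (a i) (b i) (e N) (n0 N) (introT andP (conj (e_ge0 N) eN1)) (th i) (De N i iN).
have cs : sigma2_hat h (n N) N Y @[N --> \oo] --> sigma ^+ 2.
  apply: sigma2_hat_cvg.
  - by apply: (bar (xi h) (fun n y => theta_hat h n y ^+ 2)) => N i iN eN1;
      have [] := err N i iN eN1.
  - by apply: (bar (eta h) (fun n y => theta_hat h n y ^+ 2)) => N i iN eN1;
      have [] := err N i iN eN1.
  - by apply: (bar (zeta h) (fun n y => theta_hat h n y ^+ 2)) => N i iN eN1;
      have [] := err N i iN eN1.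
exists (fun N => C * e N + 2^-1 * `|sigma2_hat h (n N) N Y - sigma ^+ 2|).
  have -> : (0 : R) = 0 + 2^-1 * `|sigma ^+ 2 - sigma ^+ 2| by rewrite subrr normr0; ring.
  apply: cvgD => //; apply: cvgMr; apply: cvg_norm; apply: cvgB => //.
  exact: cvg_cst.
near=> N; have [N0 eN1] : (0 < N)%N /\ e N <= 1 by near: N.
move=> i iN; have [h1 _ _ _] := err N i iN eN1.
have -> : phi_hat h (n N) N Y i - phi i =
    (theta_hat h (n N) (Y i) - (phi i - sigma ^+ 2 / 2)) +
    2^-1 * (sigma2_hat h (n N) N Y - sigma ^+ 2) by rewrite /phi_hat; field.
apply: le_trans (ler_normD _ _) _; apply: lerD => //.
by rewrite normrM ger0_norm.
Unshelve. all: by end_near. Qed.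

End statistics.

(** * Law of large numbers and empirical distribution functions *)

Section squares.
Variable R : realType.

Lemma square_bracket N : exists k : nat, (k ^ 2 <= N < k.+1 ^ 2)%N.
Proof.
have ex0 : exists k, (fun k => k ^ 2 <= N)%N k by exists 0%N.
have bd k : (k ^ 2 <= N -> k <= N)%N by nia.
case: (ex_maxnP ex0 bd) => k kN km; exists k; rewrite kN /= ltnNge.
by apply/negP => /km; rewrite ltnn.
Qed.

(** Between consecutive squares at most [2 * k.+1] terms of size at most 1 are added, negligible
    against [k.+1 ^ 2]. *)
Lemma cvg_average_squares (u : nat -> R) : (forall i, `|u i| <= 1) ->
  average (k.+1 ^ 2) u @[k --> \oo] --> (0 : R) ->
  average N u @[N --> \oo] --> (0 : R).
Proof.
move=> u1 a0; apply/cvgr0Pnorm_le => e e0.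
have e20 : 0 < e / 2 by rewrite divr_gt0.
have /cvgr0Pnorm_le /(_ _ e20) [K _ hK] := a0.
have [M hM] : exists M : nat, 4 / e <= M%:R.
  by exists (Num.truncn (4 / e)).+1; apply/ltW/truncnS_gt.
(* Past this threshold the bracketing [k] satisfies [K <= k] and [4 / e <= k.+1]; the latter makes
   [2 * k.+1] at most [e / 2] times [k.+1 ^ 2]. *)
exists ((K + M).+2 ^ 2)%N => // N /= KN.
have [[|k] /andP[kN Nk]] := square_bracket N.
  by move: KN Nk; clear; rewrite -!mulnn; nia.
have [Kk Mk] : (K <= k)%N /\ (M <= k.+1)%N.
  by move: KN Nk; clear; rewrite -!mulnn; nia.
have N0 : (0 < N)%N by apply: leq_trans kN; rewrite expn_gt0.
have S : `|\sum_(i < N) u i| <= `|\sum_(i < k.+1 ^ 2) u i| + (2 * k.+1)%:R.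
  rewrite -!(big_mkord xpredT u) (big_cat_nat _ kN)//=.
  apply: le_trans (ler_normD _ _) _; rewrite lerD2l.
  apply: le_trans (ler_norm_sum _ _ _) _.
  apply: (@le_trans _ _ (\sum_(k.+1 ^ 2 <= i < N) (1 : R))).
    by apply: ler_sum => i _; exact: u1.
  rewrite sumr_const_nat ler_nat; move: Nk; clear; rewrite -!mulnn; nia.
have k0 : 0 < (k.+1%:R : R) by rewrite ltr0n.
have kN' : (k.+1%:R : R) ^+ 2 <= N%:R by rewrite -natrX ler_nat.
have NR0 : 0 < (N%:R : R) by rewrite ltr0n.
have := hK k Kk; rewrite /average !normrM !normfV !normr_nat natrX.
set s := `|\sum_(i < k.+1 ^ 2) u i| in S *; set t := `|\sum_(i < N) u i| in S *.
rewrite mulrC ler_pdivrMr ?exprn_gt0// => hs.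
rewrite mulrC ler_pdivrMr//.
have Mk' : 4 / e <= k.+1%:R by apply: le_trans hM _; rewrite ler_nat.
have h1 : 4 <= k.+1%:R * e by rewrite -ler_pdivrMr.
have h2 : 2 * k.+1%:R <= e / 2 * k.+1%:R ^+ 2 by rewrite expr2; nra.
rewrite natrM in S.
have h3 : e * k.+1%:R ^+ 2 <= e * N%:R by rewrite ler_pM2l.
by apply: (le_trans S); lra.
Qed.

Lemma sum_inv_squares_le n : \sum_(k < n) ((k.+1 ^ 2)%:R^-1 : R) <= 2.
Proof.
case: n => [|n]; first by rewrite big_ord0.
suff : \sum_(k < n.+1) ((k.+1 ^ 2)%:R^-1 : R) <= 2 - n.+1%:R^-1.
  by move/le_trans; apply; rewrite gerBl invr_ge0.
elim: n => [|n IH]; first by rewrite big_ord1 invr1; lra.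
rewrite big_ord_recr /=; apply: le_trans (lerD IH (lexx _)) _.
have n0 : 0 < (n.+1%:R : R) by rewrite ltr0n.
have -> : n.+2%:R = n.+1%:R + 1 :> R by rewrite -natr1.
rewrite natrX -[n.+2%:R]natr1; move: (n.+1%:R) n0 => x n0.
have x10 : x + 1 != 0 by rewrite gt_eqF// addr_gt0.
rewrite -subr_ge0 (_ : _ - _ = (x * (x + 1) ^+ 2)^-1); last first.
  by field; rewrite x10 gt_eqF.
by rewrite invr_ge0 mulr_ge0 ?sqr_ge0// ltW.
Qed.

End squares.

Section strong_law.
Context d (T : measurableType d) (R : realType) (P : probability T R).

Lemma sqint_bounded (X : T -> R) c : measurable_fun setT X -> (forall w, `|X w| <= c) ->
  sqint P X.
Proof.
move=> mX Xc; split => //; apply: (@le_intg _ _ _ _ _ (fun=> c ^+ 2)).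
- exact: measurable_funX.
- move=> w; rewrite ger0_norm ?sqr_ge0// -[X w ^+ 2]real_normK ?num_real//.
  by rewrite ler_sqr ?nnegrE ?normr_ge0// (le_trans (normr_ge0 _) (Xc w)).
- exact: intg_cst.
Qed.

(** The squared average has mean [O(1 / N)], which is summable along the squares only; boundedness
    fills the gaps between them. *)
Lemma ae_average_cvg0 (X : nat -> T -> R) :
  (forall i, measurable_fun setT (X i)) -> (forall i w, `|X i w| <= 1) ->
  (forall i j, i != j -> expect P (fun w => X i w * X j w) = 0) ->
  {ae P, forall w, average N (X ^~ w) @[N --> \oo] --> (0 : R)}.
Proof.
move=> mX X1 X0.
have sX i : sqint P (X i) by exact: sqint_bounded (X1 i).
have sA N : sqint P (fun w => average N (X ^~ w)).
  by rewrite /average; apply: sqintZ; exact: sqint_sum.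
have E2 N : expect P (fun w => average N (X ^~ w) ^+ 2) <= 2 * N%:R^-1.
  apply: le_trans (@mean_average_sqr_le _ _ _ P X (fun i => (i == 0%N)%:R) N sX _) _.
    move=> k i; have [->|i0] := eqVneq i 0%N.
      rewrite addn0 /=; under [X in expect P X]eq_fun do rewrite -expr2.
      rewrite ger0_norm ?mean_ge0// => [|w]; last exact: sqr_ge0.
      apply: (@le_trans _ _ (expect P (fun=> 1))); last by rewrite mean_cst.
      apply: le_mean; [by case: (sX k)|exact: intg_cst|move=> w].
      by rewrite -[X k w ^+ 2]real_normK ?num_real// expr_le1.
    by rewrite X0 ?normr0 ?ler0n//; apply/eqP; lia.
  rewrite ler_pM2l// ler_piMr ?invr_ge0//.
  case: N => [|N]; first by rewrite big_ord0.
  by rewrite big_ord_recl /= big1 ?addr0.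
pose W k w := average (k.+1 ^ 2) (X ^~ w) ^+ 2.
have : {ae P, forall w, W k w @[k --> \oo] --> (0 : R)}.
  apply: (@ae_cvg0_of_mean _ _ _ _ W 4).
  - by move=> k; case: (sA (k.+1 ^ 2)%N).
  - by move=> k w; exact: sqr_ge0.
  - move=> n; apply: (@le_trans _ _ (2 * \sum_(k < n) (k.+1 ^ 2)%:R^-1)).
      by rewrite mulr_sumr; apply: ler_sum => k _; exact: E2.
    by have := sum_inv_squares_le R n; lra.
apply: filterS => w Ww; apply: cvg_average_squares => //.
apply/cvgr0Pnorm_le => e e0; have e20 : 0 < e ^+ 2 by rewrite exprn_gt0.
have /cvgr0Pnorm_le /(_ _ e20) := Ww.
apply: filterS => k; rewrite /W normrX ler_sqr// ?nnegrE//.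
exact: ltW.
Qed.

End strong_law.

Section cdf.
Context d (T : measurableType d) (R : realType) (P : probability T R).

Lemma ae_empirical_cdf_cvg (phi : nat -> {RV P >-> R}) (F : R -> R) z :
  mutually_independent P (fun i : nat =>
      preimage_set_system setT (phi i : T -> R) measurable) ->
  (forall i, cdf (phi i) z = (F z)%:E) ->
  {ae P, forall w, empirical_cdf N (fun i => phi i w) z @[N --> \oo] --> F z}.
Proof.
move=> ind Fz.
pose X i w : R := (phi i w <= z)%R%:R - F z.
have F01 : 0 <= F z <= 1.
  by have := cdf_ge0 (phi 0%N) z; have := cdf_le1 (phi 0%N) z; rewrite Fz !lee_fin => -> ->.
have mI : measurable_fun setT (fun x : R => (x <= z)%R%:R - F z : R).
  apply: measurable_funB => //.
  have -> : (fun x : R => (x <= z)%R%:R) = \1_(`]-oo, z]) :> (R -> R).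
    by apply/funext => x; rewrite indicE mem_setE in_itv.
  exact: measurable_indic.
have mX i : measurable_fun setT (X i) by exact: measurableT_comp mI _.
have X1 i w : `|X i w| <= 1.
  by rewrite /X; case: (_ <= z) => /=; rewrite ler_norml; apply/andP; split; lra.
have EX i : expect P (X i) = 0.
  rewrite /X meanB; [|apply: sqint_intg|exact: intg_cst].
    rewrite mean_cst.
    have -> : (fun w => (phi i w <= z)%R%:R : R) = \1_(phi i @^-1` `]-oo, z]).
      by apply/funext => x; rewrite indicE; congr (nat_of_bool _)%:R; apply/idP/idP; rewrite inE /= in_itv.
    rewrite /expect /Rintegral integral_indic//; last first.
      by rewrite -[X in measurable X]setTI; exact: measurable_funPT.
    by rewrite setIT -[X in fine X]/(cdf (phi i) z) Fz /= subrr.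
  apply: (@sqint_bounded _ _ _ _ _ 1).
    rewrite (_ : (fun _ => _) = (fun w => X i w + F z)); last by apply/funext => w; rewrite subrK.
    exact: measurable_funD.
  by move=> w; case: (phi i w <= z); rewrite ?normr1 ?normr0.
have : {ae P, forall w, average N (X ^~ w) @[N --> \oo] --> (0 : R)}.
  apply: ae_average_cvg0 => // i j ij.
  rewrite (@mean_indep_comp _ _ _ P (phi i) (phi j) (fun x : R => (x <= z)%R%:R - F z) (fun x : R => (x <= z)%R%:R - F z))//.
  - by rewrite -/(X i) EX mul0r.
  - exact: sqint_bounded (X1 i).
  - exact: sqint_bounded (X1 j).
  - move=> A B mA mB; apply: (mutually_independent2 ind ij).
      by exists A => //; rewrite setTI.
    by exists B => //; rewrite setTI.
apply: filterS => w Xw; apply/subr_cvg0; move: Xw; apply: cvg_trans.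
apply: near_eq_cvg; near=> N.
rewrite /X averageB average_cst//; near: N; exact: nbhs_infty_gt.
Unshelve. all: by end_near. Qed.

Lemma cdf_itv (X : {RV P >-> R}) (x y : R) : x <= y ->
  (cdf X y = cdf X x + distribution P X `]x, y])%E.
Proof.
move=> xy; rewrite /cdf -measureU//; last first.
  by apply/seteqP; split => // t /=; rewrite !in_itv/= => -[tx /andP[xt _]]; move: (lt_le_trans xt tx); rewrite ltxx.
congr (distribution P X _); apply/seteqP; split => t /=; rewrite !in_itv/=.
  by move=> ty; case: (leP t x) => [|]; [by left|move=> xt; right; rewrite ty].
by case=> [tx|/andP[]//]; exact: le_trans xy.
Qed.

Lemma distribution_setC_support (X : {RV P >-> R}) :
  distribution P X `[-1, 1] = 1%E -> distribution P X (~` `[-1, 1]) = 0%E.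
Proof.
move=> supp; have := @probability_setC _ _ _ (distribution P X) _ (measurable_itv `[-1, 1]).
move=> ->; rewrite [X in (1 - X)%E](_ : _ = 1%E) ?subee//; exact: supp.
Qed.

(** The density is bounded on [[-1, 1]], and the complement has no mass, so intervals are first
    intersected with [[-1, 1]]. A bound on the whole line is wanted because the grid used later
    extends beyond [[-1, 1]]. *)
Lemma density_bounded_cdf_lipschitz (X : {RV P >-> R}) (F f : R -> R) :
  (forall x, cdf X x = (F x)%:E) -> distribution P X `[-1, 1] = 1%E ->
  has_density X f -> [bounded f x | x in `[-1, 1]] ->
  exists2 C, 0 <= C & forall x y, `|F x - F y| <= C * `|x - y|.
Proof.
move=> cF supp [mf f0 df] [M0 [_ bf]].
pose M := `|M0| + 1; have M_ge0 : 0 <= M by rewrite addr_ge0.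
have fM x : `[-1, 1]%classic x -> f x <= M.
  move=> xI; apply: le_trans (ler_norm _) _; apply: bf => //.
  by rewrite (le_lt_trans (ler_norm _))// ltrDl.
have FM x y : x <= y -> 0 <= F y - F x <= M * (y - x).
  move=> xy; have := cdf_itv X xy; rewrite !cF.
  have Qx : distribution P X `]x, y]%classic = distribution P X (`]x, y]%classic `&` `[-1, 1]%classic).
    rewrite [LHS](measureDI (distribution P X) (B := `[-1, 1]%classic))//.
    rewrite [X in (X + _)%E](_ : _ = 0%E) ?add0e//.
    apply/eqP; rewrite eq_le measure_ge0 andbT.
    rewrite -(distribution_setC_support supp).
    apply: le_measure; rewrite ?inE//.
    - exact: measurableD.
    - exact: measurableC.
  have Q0 := cdf_nondecreasing X xy; rewrite !cF lee_fin in Q0.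
  have QM : (distribution P X `]x, y]%classic <= (M * (y - x))%:E)%E.
    rewrite Qx df; last exact: measurableI.
    apply: le_trans (@ge0_le_integral _ _ _ _ _ _ _ (cst M%:E) _ _ _ _) _.
    - exact: measurableI.
    - by move=> t _; rewrite lee_fin.
    - by apply/measurable_EFinP; exact: measurable_funTS.
    - exact: measurable_cst.
    - by move=> t [_ It]; rewrite lee_fin; exact: fM.
    rewrite integral_cst; last exact: measurableI.
    rewrite EFinM; apply: lee_wpmul2l; first by rewrite lee_fin.
    apply: (@le_trans _ _ (lebesgue_measure `]x, y]%classic)).
      by apply: le_measure; rewrite ?inE//; exact: measurableI.
    by rewrite lebesgue_measure_itv /= lte_fin; case: ltP => // _; rewrite lee_fin subr_ge0.
  move: QM; case: (distribution P X _) => [q| |]//; rewrite !lee_fin => qM [Fxy].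
  by apply/andP; split; lra.
exists M => // x y; case: (leP x y) => [|/ltW] xy.
  have /andP[a b] := FM _ _ xy; rewrite (distrC (F x)) (distrC x) !ger0_norm ?subr_ge0//; lra.
have /andP[a b] := FM _ _ xy; rewrite !ger0_norm ?subr_ge0//; lra.
Qed.

Lemma ae_support (X : {RV P >-> R}) : distribution P X `[-1, 1] = 1%E ->
  {ae P, forall w, `|X w| <= 1}.
Proof.
move=> supp; exists (X @^-1` (~` `[-1, 1]%classic)); split.
- by rewrite -[X in measurable X]setTI; apply: measurable_funPT => //; exact: measurableC.
- exact: distribution_setC_support supp.
- move=> w /= nX; rewrite in_itv /= => XI; apply: nX; rewrite ler_norml; exact: XI.
Qed.

End cdf.

(** * From a grid to uniform convergence *)

Section grid.
Variable R : realType.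

Lemma empirical_cdf_ge0 N (v : nat -> R) x : 0 <= empirical_cdf N v x.
Proof. by rewrite mulr_ge0 ?invr_ge0// sumr_ge0. Qed.

Lemma empirical_cdf_le1 N (v : nat -> R) x : empirical_cdf N v x <= 1.
Proof.
case: N => [|N]; first by rewrite /empirical_cdf /average big_ord0 mulr0.
rewrite -[leRHS](@average_cst R N.+1 1)//; apply: le_average => k _.
by rewrite lern1; case: (v k <= x).
Qed.

Lemma le_empirical_cdf N (u v : nat -> R) x y :
  (forall i, (i < N)%N -> v i <= y -> u i <= x) ->
  empirical_cdf N v y <= empirical_cdf N u x.
Proof.
move=> uv; apply: le_average => k kN; rewrite ler_nat.
by have := uv k kN; case: (_ <= y) => // /(_ isT) ->.
Qed.

Lemma near_ltn_forall (Q : nat -> nat -> Prop) L :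
  (forall l, \forall N \near \oo, Q l N) ->
  \forall N \near \oo, forall l, (l < L)%N -> Q l N.
Proof.
move=> QN; elim: L => [|L IH]; first by apply: nearW.
apply: filterS2 (QN L) IH => N QL IH l; rewrite ltnS leq_eqVlt => /orP[/eqP->//|].
exact: IH.
Qed.

(** The cell spans three grid steps: one to locate [x], and one on each side to absorb a
    perturbation of size [1 / K]. Starting the grid at -2 leaves room for this at the left end. *)
Lemma grid_cell K (x : R) : (0 < K)%N -> -1 <= x <= 1 ->
  exists2 l, (l < 3 * K)%N &
    l%:R / K%:R - 2 <= x - K%:R^-1 /\ x + K%:R^-1 <= l.+3%:R / K%:R - 2.
Proof.
move=> K0 /andP[x1 x2]; pose y := (x + 2) * K%:R - 1.
have KR : 1 <= (K%:R : R) by rewrite ler1n.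
have y0 : 0 <= y by rewrite /y; nra.
exists (Num.truncn y).
  by rewrite truncn_lt_nat// natrM /y; nra.
have /andP[t1 t2] := truncn_itv y0.
move: t1 t2; set l := Num.truncn y; have -> : l.+3%:R = l%:R + 3 :> R by rewrite -natrD addn3.
rewrite -natr1 /y; move: (l%:R) => t t1 t2.
have K1 : 0 < (K%:R : R) by rewrite ltr0n.
have E (u : R) : u = u * K%:R / K%:R by rewrite mulfK// gt_eqF.
split; rewrite -(ler_pM2r K1) !mulrBl ?mulrDl !divfK ?mulVf ?gt_eqF//; lra.
Qed.

(** Once the perturbation is below [1 / K], the perturbed function at [x] lies between the
    unperturbed ones at the ends of a cell, over which [F] varies by at most
    [3 * C / K <= e / 2]. *)
Lemma empirical_cdf_perturbed (F : R -> R) (C : R) (phi : nat -> R)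
    (v : nat -> nat -> R) (delta : nat -> R) e :
  0 < e -> 0 <= C -> (forall x y, `|F x - F y| <= C * `|x - y|) ->
  (forall x y, x <= y -> F x <= F y) ->
  (forall K l : nat,
    empirical_cdf N phi (l%:R / K%:R - 2) @[N --> \oo] --> F (l%:R / K%:R - 2)) ->
  delta N @[N --> \oo] --> (0 : R) ->
  (\forall N \near \oo, forall i, (i < N)%N -> `|v N i - phi i| <= delta N) ->
  \forall N \near \oo, forall x, -1 <= x <= 1 -> `|empirical_cdf N (v N) x - F x| <= e.
Proof.
move=> e0 C0 FC Fmon emp delta0 vphi.
have e20 : 0 < e / 2 by rewrite divr_gt0.
pose K := (Num.truncn (6 * C / e)).+1.
have K0 : 0 < (K%:R : R) by rewrite ltr0n.
have hK : 3 * C / K%:R <= e / 2.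
  by rewrite ler_pdivrMr//; have := truncnS_gt (6 * C / e); rewrite ltr_pdivrMr// -/K; lra.
have K10 : 0 < (K%:R^-1 : R) by rewrite invr_gt0.
have gridN : \forall N \near \oo, forall l, (l < 3 * K + 3)%N ->
    `|empirical_cdf N phi (l%:R / K%:R - 2) - F (l%:R / K%:R - 2)| <= e / 2.
  apply: near_ltn_forall => l.
  by have /subr_cvg0/cvgr0Pnorm_le/(_ _ e20) := emp K l.
have dN : \forall N \near \oo, delta N <= K%:R^-1.
  have /cvgr0Pnorm_le/(_ _ K10) := delta0.
  by apply: filterS => N; apply: le_trans; exact: ler_norm.
near=> N => x x1.
have gN : forall l, (l < 3 * K + 3)%N ->
  `|empirical_cdf N phi (l%:R / K%:R - 2) - F (l%:R / K%:R - 2)| <= e / 2 by near: N.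
have vN : forall i, (i < N)%N -> `|v N i - phi i| <= delta N by near: N.
have dN1 : delta N <= K%:R^-1 by near: N.
have [l lK [l1 l2]] := grid_cell (isT : (0 < K)%N) x1.
have lK0 : (l < 3 * K + 3)%N by exact: leq_trans lK (leq_addr _ _).
have lK3 : (l.+3 < 3 * K + 3)%N by rewrite -addn3 ltn_add2r.
have := gN _ lK0; have := gN _ lK3.
have l13 : l.+3%:R / K%:R - 2 - (l%:R / K%:R - 2) = 3 / K%:R :> R.
  by rewrite (_ : l.+3%:R = l%:R + 3)// ?mulrDl; [ring|rewrite -natrD addn3].
have FF := FC (l.+3%:R / K%:R - 2) (l%:R / K%:R - 2).
have d0 : 0 <= (3 / K%:R : R) by rewrite divr_ge0// ltW.
rewrite l13 (ger0_norm d0) in FF; move/(le_trans (ler_norm _)) in FF.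
have F1 : F (l%:R / K%:R - 2) <= F x by apply: Fmon; lra.
have F2 : F x <= F (l.+3%:R / K%:R - 2) by apply: Fmon; lra.
have E1 : empirical_cdf N phi (l%:R / K%:R - 2) <= empirical_cdf N (v N) x.
  apply: le_empirical_cdf => i iN hi.
  by have := le_trans (ler_norm _) (vN i iN); lra.
have E2 : empirical_cdf N (v N) x <= empirical_cdf N phi (l.+3%:R / K%:R - 2).
  apply: le_empirical_cdf => i iN hi.
  by have := vN i iN; rewrite distrC => /(le_trans (ler_norm _)); lra.
move: E1 E2 F1 F2 FF; set p := empirical_cdf _ _ _; set q := empirical_cdf _ _ _.
set r := empirical_cdf _ _ _; set F1 := F _; set F2 := F _; set F3 := F _.
clearbody p q r F1 F2 F3 => E1 E2 h1 h2 FF.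
rewrite !ler_norml => /andP[a1 a2] /andP[b1 b2].
by apply/andP; split; lra.
Unshelve. all: by end_near. Qed.

End grid.

(** * Convergence of the Lagrange estimator *)

Section interpolation.
Variable R : realType.

Lemma sup_norm_cvg0 (G : nat -> R -> R) :
  (forall e, 0 < e -> \forall N \near \oo, forall x, -1 <= x <= 1 -> `|G N x| <= e) ->
  sup_norm (G N) @[N --> \oo] --> 0%E.
Proof.
move=> Ge.
have sup_ge0 N : (0 <= sup_norm (G N))%E.
  apply: (@le_trans _ _ `|G N 0|%:E); first by rewrite lee_fin.
  by apply: ereal_sup_ubound; exists 0 => //=; rewrite in_itv /=; apply/andP; split; lra.
have sup_le e : 0 < e -> \forall N \near \oo, (sup_norm (G N) <= e%:E)%E.
  move=> /Ge; apply: filterS => N GN; apply: ge_ereal_sup => _ [x xI <-].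
  by rewrite lee_fin GN//; move: xI; rewrite /= in_itv.
apply/fine_cvgP; split.
  have := sup_le 1 ltr01; apply: filterS => N le1.
  by rewrite ge0_fin_numE// (le_lt_trans le1)// ltry.
apply/cvgr0Pnorm_le => e /sup_le; apply: filterS => N /=.
by have := sup_ge0 N; case: (sup_norm (G N)) => [r| |]//=; rewrite !lee_fin => /ger0_norm ->.
Qed.

Lemma cheb_node_itv m j : (j < m)%N -> -1 <= cheb_node R m j <= 1.
Proof. by move=> jm; rewrite /cheb_node cos_geN1 cos_le1. Qed.

Lemma cheb_node_decr m j : (j.+1 < m)%N -> cheb_node R m j.+1 <= cheb_node R m j.
Proof.
move=> jm; have m0 : (0 < m)%N by apply: leq_trans jm.
have I i : (i < m)%N -> cheb_angle R m i \in `[0, pi].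
  by move=> im; rewrite in_itv /= !ltW ?cheb_angle_gt0 ?cheb_angle_ltpi.
rewrite !cheb_nodeE leNgt ltr_cos ?I ?(ltnW jm)// -leNgt.
exact: ler_cheb_angle.
Qed.

Lemma lagrange_monotone_cvg (m : nat -> nat) (g : nat -> R -> R) (F : R -> R) C :
  (forall N, (0 < m N)%N) -> m N @[N --> \oo] --> \oo ->
  (forall N x, 0 <= g N x <= 1) -> (forall N x y, x <= y -> g N x <= g N y) ->
  (forall x, 0 <= F x <= 1) ->
  0 <= C -> (forall x y, `|F x - F y| <= C * `|x - y|) ->
  (forall e, 0 < e -> \forall N \near \oo, forall x, -1 <= x <= 1 -> `|g N x - F x| <= e) ->
  sup_norm (fun x : R =>
    \sum_(j < m N) g N (cheb_node R (m N) j) * lagrange_basis j x - F x)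
  @[N --> \oo] --> 0%E.
Proof.
move=> m0 moo g01 gmon F01 C0 FC gF; apply: sup_norm_cvg0 => e e0.
(* The error budget: the tails get [e / 2], while the error at the nodes and the Lipschitz term get
   [e / 4] each after multiplication by [A]. [K] is fixed before [N], so [m N] eventually dominates
   it. *)
pose K := (Num.truncn (8 / e)).+1.
have K0 : 0 < (K%:R : R) by rewrite ltr0n.
have K4 : 4 / K%:R <= e / 2.
  by rewrite ler_pdivrMr//; have := truncnS_gt (8 / e); rewrite ltr_pdivrMr// -/K; lra.
pose A : R := (2 * K + 1)%:R * 2.
have A0 : 0 < A by rewrite mulr_gt0 ?ltr0n ?addn1.
pose M := (Num.truncn (4 * A * (C * (K%:R + 1) * pi) / e)).+1.
have eA0 : 0 < e / (4 * A) by rewrite divr_gt0// mulr_gt0.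
have hM : \forall N \near \oo, (M <= m N)%N by move/cvgnyPge: moo; apply.
near=> N => x x1.
have MN : (M <= m N)%N by near: N.
have gFN : forall x, -1 <= x <= 1 -> `|g N x - F x| <= e / (4 * A) by near: N; exact: gF.
have := @lagrange_monotone_approx R (m N) K (fun j => g N (cheb_node R (m N) j)) F
  (e / (4 * A)) C (acos x) (m0 N) isT.
rewrite acosK; last by rewrite in_itv.
move=> /(_ _ _ _ (F01 x) C0 FC) H; apply: le_trans (H _ _ _ _) _.
- by rewrite acos_ge0// acos_lepi.
- by move=> j jm; exact: g01.
- by move=> j jm; apply: gmon; exact: cheb_node_decr.
- by move=> j jm; apply: gFN; exact: cheb_node_itv jm.
have mN0 : 0 < ((m N)%:R : R) by rewrite ltr0n.
have B : C * (K%:R + 1) * pi / (m N)%:R <= e / (4 * A).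
  have A40 : 0 < 4 * A by rewrite mulr_gt0.
  rewrite ler_pdivrMr// [leRHS]mulrAC ler_pdivlMr// mulrC [leRHS]mulrC -ler_pdivrMr//.
  by apply: le_trans (ltW (truncnS_gt _)) _; rewrite ler_nat.
rewrite -/A.
have h1 : A * (e / (4 * A)) = e / 4 by field; rewrite gt_eqF.
have h2 : A * (C * (K%:R + 1) * pi / (m N)%:R) <= e / 4 by rewrite -h1 ler_pM2l.
rewrite mulrDr h1; move: h2 K4; clear.
set u := A * _; set v := 4 / _; clearbody u v; lra.
Unshelve. all: by end_near. Qed.

End interpolation.

Theorem theorem2 (R : realType) (d : measure_display)
    (Omega : measurableType d) (P : probability Omega R)
    (sigma gamma H h : R)
    (sigma_gt0 : 0 < sigma) (gamma_gt0 : 0 < gamma)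
    (H_range : 2^-1 < H < 1) (h_gt0 : 0 < h)
    (B BH : nat -> R -> {RV P >-> R}) (phi : nat -> {RV P >-> R})
    (B_bm : forall i, is_brownian_motion P (fun t => B i t : Omega -> R))
    (BH_fbm : forall i,
      is_fractional_brownian_motion P H (fun t => BH i t : Omega -> R))
    (noise_indep : mutually_independent P (fun j : nat + nat =>
      match j with
      | inl i => sigma_of [set t : R | 0 <= t] (fun t => B i t : Omega -> R)
      | inr i => sigma_of [set t : R | 0 <= t] (fun t => BH i t : Omega -> R)
      end))
    (phi_indep : mutually_independent P (fun i : nat =>
      preimage_set_system setT (phi i : Omega -> R) measurable))
    (phi_noise_indep : independent2 P
      (sigma_of [set: nat] (fun i => phi i : Omega -> R))
      (sigma_of [set it : nat * R | 0 <= it.2]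
        (fun it => mixed_fbm sigma gamma (fun i t => B i t : Omega -> R)
                     (fun i t => BH i t : Omega -> R) it.1 it.2)))
    (F f df : R -> R)
    (phi_cdf : forall i x, cdf (phi i) x = (F x)%:E)
    (phi_supp : forall i, distribution P (phi i) `[-1, 1] = 1%E)
    (phi_density : forall i, has_density (phi i) f)
    (A1 : forall i, ('E_P[fun w => (phi i w ^+ 4)%R] < +oo)%E)
    (A2 : class_C 2 `[-1, 1] F)
    (A3_diff : has_derivative_on `[-1, 1] f df)
    (A3_f : [bounded f x | x in `[-1, 1]])
    (A3_df : [bounded df x | x in `[-1, 1]])
    (m : nat -> nat) (m_gt0 : forall N, (0 < m N)%N)
    (m_infty : m N @[N --> \oo] --> \oo)
    (m_growth :
      ln ((m N)%:R : R) / (m N)%:R ^+ 2 @[N --> \oo] --> (0 : R)) :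
  exists n : nat -> nat,
    (n N @[N --> \oo] --> \oo) /\
    {ae P, forall w,
      sup_norm (fun x : R =>
        lagrange_estimator h (m N) (n N) N
          (fun i t => observed sigma gamma (fun i t => B i t : Omega -> R)
                        (fun i t => BH i t : Omega -> R)
                        (fun i => phi i : Omega -> R) i t w) x - F x)
      @[N --> \oo] --> 0%E}.
Proof.
have Z i : vanishing P (fun n w => noise_defect h H n (fun t => B i t w) (fun t => BH i t w)).
  apply: (@noise_vanishing _ _ _ P h H h_gt0 H_range (fun t => B i t) (fun t => BH i t)) => //.
  by move=> A A' BA BHA'; apply: (mutually_independent2 noise_indep (i := inl i) (j := inr i)).
have [n [nN nD]] := vanishing_diagonal Z.
exists n; split.
  apply/cvgnyPge => k; near=> N; apply: leq_trans (ltnW (nN N)).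
  by near: N; exact: nbhs_infty_ge.
have [C C0 FC] :=
  density_bounded_cdf_lipschitz (phi_cdf 0%N) (phi_supp 0%N) (phi_density 0%N) A3_f.
have Fmon x y : x <= y -> F x <= F y.
  by move/(cdf_nondecreasing (phi 0%N)); rewrite !phi_cdf lee_fin.
have F01 x : 0 <= F x <= 1.
  by have := cdf_ge0 (phi 0%N) x; have := cdf_le1 (phi 0%N) x; rewrite phi_cdf !lee_fin => -> ->.
have : {ae P, forall w, forall i, `|phi i w| <= 1}.
  by apply: ae_foralln => i; exact: ae_support.
(* The grid points are countably many, so one null set serves all grids. *)
have : {ae P, forall w, forall K l : nat,
    empirical_cdf N (fun i => phi i w) (l%:R / K%:R - 2) @[N --> \oo] --> F (l%:R / K%:R - 2)}.
  apply: ae_foralln => K; apply: ae_foralln => l.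
  exact: ae_empirical_cdf_cvg.
(* From here on the sample point [w] is fixed and the argument is deterministic. *)
move: nD; apply: filterS3 => w Dw emp phi1.
have [delta delta0 hdelta] := @phi_hat_uniform_cvg R h H sigma gamma h_gt0 H_range
  sigma_gt0 gamma_gt0 n (fun i t => B i t w) (fun i t => BH i t w) (fun i => phi i w)
  phi1 (fun N => leq_trans (ltn0Sn _) (nN N)) Dw.
apply: (@lagrange_monotone_cvg _ m (fun N => empirical_cdf N
  (phi_hat h (n N) N (fun i t => (phi i w - sigma ^+ 2 / 2) * t +
    (sigma * B i t w + gamma * BH i t w)))) F C) => //.
- by move=> N x; rewrite empirical_cdf_ge0 empirical_cdf_le1.
- by move=> N x y xy; apply: le_empirical_cdf => i _ /le_trans; apply.
- move=> e e0; apply: (empirical_cdf_perturbed e0 C0 FC Fmon emp delta0); exact: hdelta.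
Unshelve. all: by end_near. Qed.
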